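(* Let $X$ and $Y$ be connected, locally path-connected, semilocally simply-connected topological spaces, let $f:X\to Y$ be continuous, let $x_0\in X$ and $y_0:=f(x_0)$, and let $f_{\sharp}:\pi_1(X,x_0)\to\pi_1(Y,y_0)$ be the induced homomorphism. Then $f_{\sharp}$ is surjective if and only if the topological pullback functor $f^{\ast}:\mathrm{Cov}(Y)\to\mathrm{Cov}(X)$ is essentially injective.
   Context: Spaces are not required to be Hausdorff. $\mathrm{Cov}(Y)$ is the category of unbased coverings $p:E\to Y$ ($E$ may be disconnected or empty); a morphism from $p_1:E_1\to Y$ to $p_2:E_2\to Y$ is a continuous map $t:E_1\to E_2$ with $p_1=p_2\circ t$. The topological pullback functor $f^{\ast}:\mathrm{Cov}(Y)\to\mathrm{Cov}(X)$ sends $p:E\to Y$ to $f^{\ast}(p):f^{\ast}(E)\to X$, where $f^{\ast}(E):=\{(x,e)\in X\times E\mid f(x)=p(e)\}$ (a subspace of $X\times E$) and $f^{\ast}(p)$ is the restriction of the projection to $X$; it sends a morphism $t$ to the restriction of $\mathrm{id}_X\times t$. A functor $F:C\to D$ is essentially injective provided: for all objects $x,y$ of $C$, if $F(x)\cong F(y)$ then $x\cong y$. *)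

(* Defs.v *)
From HB Require Import structures.
From mathcomp Require Import all_boot all_order all_algebra generic_quotient.
From mathcomp Require Import boolp classical_sets functions set_interval.
From mathcomp Require Import ring lra.
From mathcomp Require Import reals topology normedtype homotopy.

Set Implicit Arguments.
Unset Strict Implicit.
Unset Printing Implicit Defensive.

Import Order.TTheory GRing.Theory Num.Theory.
Import numFieldTopology.Exports numFieldNormedType.Exports.

Local Open Scope classical_set_scope.
Local Open Scope ring_scope.
Local Open Scope quotient_scope.

Record category := Category {
  obj :> Type ;
  hom : obj -> obj -> Type ;
  idm : forall a, hom a a ;
  compm : forall a b c, hom b c -> hom a b -> hom a c ;
  comp1m : forall a b (u : hom a b), compm (idm b) u = u ;
  compm1 : forall a b (u : hom a b), compm u (idm a) = u ;
  compmA : forall a b c d (u : hom a b) (v : hom b c) (w : hom c d),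
    compm w (compm v u) = compm (compm w v) u }.
Arguments hom {_} _ _.
Arguments idm {_} _.
Arguments compm {_ _ _ _} _ _.

Record functor (C D : category) := Functor {
  fobj :> C -> D ;
  fmap : forall a b : C, hom a b -> hom (fobj a) (fobj b) ;
  fmap_id : forall a, fmap (idm a) = idm (fobj a) ;
  fmap_comp : forall (a b c : C) (v : hom b c) (u : hom a b),
    fmap (compm v u) = compm (fmap v) (fmap u) }.

Definition isomorphic (C : category) (a b : C) : Prop :=
  exists (u : hom a b) (v : hom b a),
    compm v u = idm a /\ compm u v = idm b.

Definition essentially_injective (C D : category) (F : functor C D) : Prop :=
  forall a b : C, isomorphic (F a) (F b) -> isomorphic a b.

(* [set_type] carries the initial topology of its inclusion, here and in the
   rest of the file. *)
Definition unit_interval (R : realType) : Type := set_type `[0 : R, 1]%classic.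

Section unit_interval.
Context {R : realType}.
Local Notation I := (unit_interval R).

HB.instance Definition _ := Topological.copy I (set_type `[0 : R, 1]%classic).

Definition uval (t : I) : R := set_val t.

Lemma uvalP (t : I) : 0 <= uval t <= 1.
Proof.
by rewrite /uval; have := set_valP t; rewrite /= in_itv.
Qed.

Fact clamp_subproof (r : R) :
  Num.max 0 (Num.min r 1) \in `[0 : R, 1]%classic.
Proof.
apply/mem_set; rewrite /= in_itv /= le_max lexx /=.
by rewrite ge_max ler01 ge_min lexx orbT.
Qed.

Definition clamp (r : R) : I := 
  exist (fun x : R => x \in `[0 : R, 1]%classic) _ (clamp_subproof r).

Lemma uval_clamp (r : R) : 0 <= r <= 1 -> uval (clamp r) = r.
Proof.
move=> /andP[r0 r1]; rewrite /uval set_valE /=.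
by rewrite (min_idPl r1) (max_idPr r0).
Qed.

Lemma uvalK : cancel uval clamp.
Proof.
move=> t; apply: val_inj; rewrite -set_valE -/(uval (clamp _)).
by rewrite uval_clamp // uvalP.
Qed.

Lemma clamp0 r : r <= 0 -> clamp r = clamp 0.
Proof.
move=> r0; apply: val_inj => /=.
have r1 := le_trans r0 (@ler01 R).
by rewrite (min_idPl r1) (max_idPl r0) (min_idPl ler01) maxxx.
Qed.

Lemma clamp1 r : 1 <= r -> clamp r = clamp 1.
Proof. by move=> r1; apply: val_inj => /=; rewrite (min_idPr r1) minxx. Qed.

Lemma uval_continuous : continuous uval.
Proof. exact: (@initial_continuous _ R set_val). Qed.

Lemma clamp_continuous : continuous clamp.
Proof.
have c : continuous ((cst 0 : R -> R^o) \max (id \min cst 1)).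
  move=> r; apply: continuous_max; first exact: cvg_cst.
  by apply: continuous_min; [exact: cvg_id|exact: cvg_cst].
exact: (@continuous_comp_initial _ _ _ set_val).
Qed.

Fact clamp01_neq : clamp 0 != clamp 1.
Proof.
apply/negP => /eqP/(congr1 uval); rewrite !uval_clamp ?lexx ?ler01 //.
by move/eqP; rewrite eq_sym oner_eq0.
Qed.

HB.instance Definition _ := isBiPointed.Build I clamp01_neq.

Lemma uval0 : uval zero = 0.
Proof. by rewrite uval_clamp // lexx ler01. Qed.

Lemma uval1 : uval one = 1.
Proof. by rewrite uval_clamp // lexx ler01. Qed.

End unit_interval.

Definition path_homotopic (R : realType) (X : topologicalType) (x y : X)
    (p q : {path (unit_interval R) from x to y}) : Prop :=
  exists H : unit_interval R * unit_interval R -> X,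
    [/\ continuous H,
        forall t, H (zero, t) = p t,
        forall t, H (one, t) = q t,
        forall s, H (s, zero) = x
      & forall s, H (s, one) = y].

Lemma continuous_paste (R : realType) (Z X : topologicalType) (a : Z -> R)
    (c : R) (f g : Z -> X) :
  continuous a -> continuous f -> continuous g ->
  (forall z, a z = c -> f z = g z) ->
  continuous (fun z => if a z <= c then f z else g z).
Proof.
move=> ca cf cg fg; apply/continuous_closedP => A cA.
rewrite [X in closed X](_ : _ =
  ((a @^-1` [set r | r <= c]) `&` (f @^-1` A)) `|`
  ((a @^-1` [set r | c <= r]) `&` (g @^-1` A))); last first.
  apply/seteqP; split => z /=.
    by case: (leP (a z) c) => [ac Af|/ltW ca' Ag]; [left|right].
  case=> -[ac Az]; first by rewrite ac.
  by case: (leP (a z) c) => // ca'; rewrite fg //; apply/eqP; rewrite eq_le ac ca'.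
apply: closedU; apply: closedI.
- by apply: (continuous_closedP _).1 => //; exact: closed_le.
- exact: (continuous_closedP _).1.
- by apply: (continuous_closedP _).1 => //; exact: closed_ge.
- exact: (continuous_closedP _).1.
Qed.

Section real_continuity.
Context {R : realType} {Z : topologicalType}.
Implicit Types a b : Z -> R.

Lemma contC (k : R) : continuous (fun _ : Z => k).
Proof. by move=> z; exact: cvg_cst. Qed.

Lemma contD a b : continuous a -> continuous b ->
  continuous (fun z => a z + b z).
Proof. by move=> ca cb z; apply: cvgD; [exact: ca|exact: cb]. Qed.

Lemma contB a b : continuous a -> continuous b ->
  continuous (fun z => a z - b z).
Proof. by move=> ca cb z; apply: cvgB; [exact: ca|exact: cb]. Qed.

Lemma contM a b : continuous a -> continuous b ->
  continuous (fun z => a z * b z).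
Proof. by move=> ca cb z; apply: cvgM; [exact: ca|exact: cb]. Qed.

Lemma contN a : continuous a -> continuous (fun z => `|a z|).
Proof. by move=> ca z; apply: cvg_norm; exact: ca. Qed.

Lemma contmin a b : continuous a -> continuous b ->
  continuous (fun z => Num.min (a z) (b z)).
Proof.
move=> ca cb z; apply: (@continuous_min R Z (a : Z -> R^o) (b : Z -> R^o)).
  exact: ca.
exact: cb.
Qed.

Lemma contmax a b : continuous a -> continuous b ->
  continuous (fun z => Num.max (a z) (b z)).
Proof.
move=> ca cb z; apply: (@continuous_max R Z (a : Z -> R^o) (b : Z -> R^o)).
  exact: ca.
exact: cb.
Qed.

Lemma contU (a : Z -> unit_interval R) : continuous a ->
  continuous (fun z => uval (a z)).
Proof.
by move=> ca z; apply: continuous_comp; [exact: ca|exact: uval_continuous].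
Qed.

End real_continuity.

Lemma continuous_clamp (R : realType) (Z : topologicalType) (a : Z -> R) :
  continuous a -> continuous (fun z => clamp (a z)).
Proof.
by move=> ca z; apply: continuous_comp; [exact: ca|exact: clamp_continuous].
Qed.

Lemma cont_fst (T U : topologicalType) : continuous (@fst T U).
Proof. by move=> w; exact: cvg_fst. Qed.

Lemma cont_snd (T U : topologicalType) : continuous (@snd T U).
Proof. by move=> w; exact: cvg_snd. Qed.

Lemma cont_id (T : topologicalType) : continuous (fun t : T => t).
Proof. by move=> t; exact: cvg_id. Qed.

Lemma cont_comp (T U V : topologicalType) (a : T -> U) (b : U -> V) :
  continuous a -> continuous b -> continuous (fun t => b (a t)).
Proof. by move=> ca cb t; apply: continuous_comp; [exact: ca|exact: cb]. Qed.

Local Ltac cont :=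
  repeat match goal with
  | |- continuous _ => first [assumption | exact: contC | exact: cont_fst
     | exact: cont_snd | exact: cont_id | exact: uval_continuous
     | apply: contmin | apply: contmax | apply: contN | apply: contB
     | apply: contD | apply: contM | apply: contU | apply: continuous_clamp]
  end.

Section paths.
Context {R : realType} {X : topologicalType}.
Local Notation I := (unit_interval R).
Local Notation path x y := {path I from x to y in X}.
Implicit Types x y : X.

Lemma continuous_path_clamp (Z : topologicalType) x y (p : path x y)
    (a : Z -> R) :
  continuous a -> continuous (fun z => p (clamp (a z))).
Proof.
move=> ca z; apply: (@continuous_comp _ _ _ (fun z => clamp (a z)) p).
  exact: continuous_clamp.
exact: cts_fun.
Qed.

Lemma continuous_pair (Z T U : topologicalType) (a : Z -> T) (b : Z -> U) :
  continuous a -> continuous b -> continuous (fun z => (a z, b z)).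
Proof.
by move=> ca cb z; apply: (@cvg_pair _ _ _ (nbhs z)); [exact: ca|exact: cb].
Qed.

Lemma continuous_comp2 (Z T U V : topologicalType) (H : T * U -> V)
    (a : Z -> T) (b : Z -> U) :
  continuous H -> continuous a -> continuous b ->
  continuous (fun z => H (a z, b z)).
Proof.
move=> cH ca cb z; apply: (@continuous_comp _ _ _ (fun z => (a z, b z)) H).
  exact: continuous_pair.
exact: cH.
Qed.

Lemma path_clamp0 x y (p : path x y) r : r <= 0 -> p (clamp r) = x.
Proof. by move=> r0; rewrite clamp0 //; exact: (path_zero (s := p)). Qed.

Lemma path_clamp1 x y (p : path x y) r : 1 <= r -> p (clamp r) = y.
Proof. by move=> r1; rewrite clamp1 //; exact: (path_one (s := p)). Qed.

Lemma path_uval x y (p : path x y) t : p t = p (clamp (uval t)).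
Proof. by rewrite uvalK. Qed.

(* Homotopic reparametrizations of a path, by a straight-line homotopy. *)
Lemma reparam_homotopic x y u v (p : path x y) (P Q : path u v)
    (r s : I -> R) :
  continuous r -> continuous s -> r zero = s zero -> r one = s one ->
  (forall t, P t = p (clamp (r t))) -> (forall t, Q t = p (clamp (s t))) ->
  path_homotopic P Q.
Proof.
move=> cr cs r0 r1 Pr Qs.
exists (fun w => p (clamp (r w.2 + uval w.1 * (s w.2 - r w.2)))); split => /=.
- apply: continuous_path_clamp; apply: contD; last apply: contM; cont.
  + by move=> w; apply: continuous_comp; [exact: cvg_snd|exact: cr].
  + by move=> w; apply: continuous_comp; [exact: cvg_snd|exact: cs].
  + by move=> w; apply: continuous_comp; [exact: cvg_snd|exact: cr].
- by move=> t; rewrite uval0 mul0r addr0 -Pr.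
- by move=> t; rewrite uval1 mul1r addrC subrK -Qs.
- by move=> t; rewrite -r0 subrr mulr0 addr0 -Pr; exact: (path_zero (s := P)).
- by move=> t; rewrite -r1 subrr mulr0 addr0 -Pr; exact: (path_one (s := P)).
Qed.

Lemma path_homotopic_refl x y (p : path x y) : path_homotopic p p.
Proof.
by apply: (@reparam_homotopic _ _ _ _ p p p uval uval) => //;
  [exact: uval_continuous..|exact: path_uval|exact: path_uval].
Qed.

Lemma path_homotopic_sym x y (p q : path x y) :
  path_homotopic p q -> path_homotopic q p.
Proof.
move=> [H [cH H0 H1 Hx Hy]].
exists (fun w => H (clamp (1 - uval w.1), w.2)); split => //=.
- by apply: continuous_comp2; cont.
- by move=> t; rewrite uval0 subr0 -H1.
- by move=> t; rewrite uval1 subrr -H0.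
Qed.

Lemma path_homotopic_trans x y (p q r : path x y) :
  path_homotopic p q -> path_homotopic q r -> path_homotopic p r.
Proof.
move=> [H [cH H0 H1 Hx Hy]] [K [cK K0 K1 Kx Ky]].
exists (fun w => if uval w.1 <= 2^-1 then H (clamp (2 * uval w.1), w.2)
  else K (clamp (2 * uval w.1 - 1), w.2)); split => /=.
- apply: continuous_paste; [by cont|by apply: continuous_comp2; cont..|].
  by move=> w ->; rewrite divff ?pnatr_eq0 // subrr (H1 w.2) (K0 w.2).
- by move=> t; rewrite uval0 invr_ge0 ler0n mulr0 -/zero H0.
- move=> t; rewrite uval1 mulr1 invf_ge1 // lern1 /=.
  by rewrite (_ : 2 - 1 = 1 :> R) -/one ?K1 //; lra.
- by move=> s; case: ifP => _; rewrite ?Hx ?Kx.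
- by move=> s; case: ifP => _; rewrite ?Hy ?Ky.
Qed.

Definition path_cat_fun x y z (p : path x y) (q : path y z) (t : I) : X :=
  if uval t <= 2^-1 then p (clamp (2 * uval t)) else q (clamp (2 * uval t - 1)).

Fact path_cat_continuous x y z (p : path x y) (q : path y z) :
  continuous (path_cat_fun p q).
Proof.
apply: continuous_paste; [by cont|by apply: continuous_path_clamp; cont..|].
by move=> t ->; rewrite path_clamp1 ?path_clamp0 ?divff ?pnatr_eq0 // subrr.
Qed.

Fact path_cat_zero x y z (p : path x y) (q : path y z) :
  path_cat_fun p q zero = x.
Proof.
by rewrite /path_cat_fun uval0 invr_ge0 ler0n path_clamp0 // mulr0.
Qed.

Fact path_cat_one x y z (p : path x y) (q : path y z) :
  path_cat_fun p q one = z.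
Proof.
rewrite /path_cat_fun uval1 invf_ge1 // lern1 /= path_clamp1 // mulr1.
by rewrite (_ : 2 - 1 = 1 :> R) //; lra.
Qed.

Definition path_cat x y z (p : path x y) (q : path y z) : path x z :=
  mk_path (@path_cat_continuous _ _ _ p q) (path_cat_zero p q) (path_cat_one p q).

Definition path_rev_fun x y (p : path x y) (t : I) : X :=
  p (clamp (1 - uval t)).

Fact path_rev_continuous x y (p : path x y) : continuous (path_rev_fun p).
Proof.
by apply: continuous_path_clamp; cont.
Qed.

Fact path_rev_zero x y (p : path x y) : path_rev_fun p zero = y.
Proof. by rewrite /path_rev_fun uval0 path_clamp1 // subr0. Qed.

Fact path_rev_one x y (p : path x y) : path_rev_fun p one = x.
Proof. by rewrite /path_rev_fun uval1 path_clamp0 // subrr. Qed.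

Definition path_rev x y (p : path x y) : path y x :=
  mk_path (@path_rev_continuous _ _ p) (path_rev_zero p) (path_rev_one p).

Definition path_cst x : path x x := cst x.

Lemma path_cat_clamp x y z (p : path x y) (q : path y z) r :
  path_cat p q (clamp r) =
  if r <= 2^-1 then p (clamp (2 * r)) else q (clamp (2 * r - 1)).
Proof.
rewrite /path_cat /= /mk_path /= /path_cat_fun.
have [r0|r0] := leP r 0.
  rewrite (clamp0 r0) uval_clamp ?lexx ?ler01 // invr_ge0 ler0n.
  by rewrite ifT ?(path_clamp0 p); [by []|lra..].
have [r1|r1] := leP 1 r.
  rewrite (clamp1 r1) uval_clamp ?lexx ?ler01 //.
  rewrite !ifF; [|by lra..].
  by rewrite !(path_clamp1 q); [by []|lra..].
by rewrite uval_clamp // !ltW.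
Qed.

Lemma path_rev_clamp x y (p : path x y) r :
  path_rev p (clamp r) = p (clamp (1 - r)).
Proof.
rewrite /path_rev /= /mk_path /= /path_rev_fun.
have [r0|r0] := leP r 0.
  rewrite (clamp0 r0) uval_clamp ?lexx ?ler01 //.
  by rewrite !(path_clamp1 p); [by []|lra..].
have [r1|r1] := leP 1 r.
  rewrite (clamp1 r1) uval_clamp ?lexx ?ler01 //.
  by rewrite !(path_clamp0 p); [by []|lra..].
by rewrite uval_clamp // !ltW.
Qed.

Lemma path_cat_homotopic x y z (p p' : path x y) (q q' : path y z) :
  path_homotopic p p' -> path_homotopic q q' ->
  path_homotopic (path_cat p q) (path_cat p' q').
Proof.
move=> [H [cH H0 H1 Hx Hy]] [K [cK K0 K1 Kx Ky]].
exists (fun w => if uval w.2 <= 2^-1 then H (w.1, clamp (2 * uval w.2))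
  else K (w.1, clamp (2 * uval w.2 - 1))); split => /=.
- apply: continuous_paste; [by cont|by apply: continuous_comp2; cont..|].
  by move=> w ->; rewrite divff ?pnatr_eq0 // subrr (Hy w.1) (Kx w.1).
- by move=> t; rewrite H0 K0.
- by move=> t; rewrite H1 K1.
- by move=> s; rewrite uval0 invr_ge0 ler0n mulr0 Hx.
- move=> s; rewrite uval1 mulr1 invf_ge1 // lern1 /=.
  by rewrite (_ : 2 - 1 = 1 :> R) ?Ky //; lra.
Qed.

Lemma path_rev_homotopic x y (p p' : path x y) :
  path_homotopic p p' -> path_homotopic (path_rev p) (path_rev p').
Proof.
move=> [H [cH H0 H1 Hx Hy]].
exists (fun w => H (w.1, clamp (1 - uval w.2))); split => /=.
- by apply: continuous_comp2; cont.
- by move=> t; rewrite H0.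
- by move=> t; rewrite H1.
- by move=> s; rewrite uval0 subr0 Hy.
- by move=> s; rewrite uval1 subrr Hx.
Qed.

Lemma path_catA x y z w (p : path x y) (q : path y z) (r : path z w) :
  path_homotopic (path_cat p (path_cat q r)) (path_cat (path_cat p q) r).
Proof.
pose phi (t : I) : R :=
  Num.min (2 * uval t) (Num.min (uval t + 4^-1) (2^-1 * (uval t + 1))).
apply: (@reparam_homotopic _ _ _ _ (path_cat p (path_cat q r)) _ _ uval phi).
- exact: uval_continuous.
- by rewrite /phi; cont.
- by rewrite /phi uval0 !minElt; do !case: ifP; lra.
- by rewrite /phi uval1 !minElt; do !case: ifP; lra.
- exact: path_uval.
move=> t; rewrite [LHS]path_uval !path_cat_clamp.
have /andP[t0 t1] := uvalP t; rewrite /phi; set u := uval t in t0 t1 *.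
have [ua|ua] := leP u 4^-1.
  rewrite (_ : Num.min (2 * u) _ = 2 * u); last first.
    by rewrite !minElt; repeat case: ifP; lra.
  by rewrite !ifT //; lra.
have [ub|ub] := leP u 2^-1.
  rewrite (_ : Num.min (2 * u) _ = u + 4^-1); last first.
    by rewrite !minElt; repeat case: ifP; lra.
  rewrite (_ : (2 * u <= 2^-1) = false); last by lra.
  rewrite (_ : (u + 4^-1 <= 2^-1) = false); last by lra.
  rewrite ifT; last by lra.
  by congr (q (clamp _)); lra.
rewrite (_ : Num.min (2 * u) _ = 2^-1 * (u + 1)); last first.
  by rewrite !minElt; repeat case: ifP; lra.
rewrite (_ : (2^-1 * (u + 1) <= 2^-1) = false); last by lra.
rewrite ifF; last by lra.
by congr (r (clamp _)); lra.
Qed.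

Lemma path_cat1p x y (p : path x y) :
  path_homotopic (path_cat (path_cst x) p) p.
Proof.
apply: (@reparam_homotopic _ _ _ _ p _ _
  (fun t => Num.max 0 (2 * uval t - 1)) uval).
- by cont.
- by cont.
- by rewrite uval0 maxElt; case: ifP; lra.
- by rewrite uval1 maxElt; case: ifP; lra.
- move=> t; rewrite [LHS]path_uval path_cat_clamp maxElt.
  case: ifP => h; case: ifP => k //; [by exfalso; lra| |by exfalso; lra].
  by rewrite (path_clamp0 p).
- exact: path_uval.
Qed.

Lemma path_catp1 x y (p : path x y) :
  path_homotopic (path_cat p (path_cst y)) p.
Proof.
apply: (@reparam_homotopic _ _ _ _ p _ _
  (fun t => Num.min 1 (2 * uval t)) uval).
- by cont.
- by cont.
- by rewrite uval0 minElt; case: ifP; lra.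
- by rewrite uval1 minElt; case: ifP; lra.
- move=> t; rewrite [LHS]path_uval path_cat_clamp minElt.
  case: ifP => h; case: ifP => k //; last by exfalso; lra.
    by rewrite !(path_clamp1 p); [by []|lra..].
  by rewrite (path_clamp1 p).
- exact: path_uval.
Qed.

Lemma path_cat_rev x y (p : path x y) :
  path_homotopic (path_cat p (path_rev p)) (path_cst x).
Proof.
apply: (@reparam_homotopic _ _ _ _ p _ _
  (fun t => 1 - `|2 * uval t - 1|) (cst 0)).
- by cont.
- by cont.
- by rewrite uval0 mulr0 sub0r normrN1 subrr.
- by rewrite uval1 mulr1 (_ : 2 - 1 = 1 :> R) ?normr1 ?subrr //; lra.
- move=> t; rewrite [LHS]path_uval path_cat_clamp path_rev_clamp.
  case: ifP => h.
    by rewrite ler0_norm; [congr (p (clamp _)); lra|lra].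
  by rewrite ger0_norm; [congr (p (clamp _)); lra|lra].
- by move=> t; rewrite path_clamp0.
Qed.

Lemma path_rev_cat x y (p : path x y) :
  path_homotopic (path_cat (path_rev p) p) (path_cst y).
Proof.
apply: (@reparam_homotopic _ _ _ _ p _ _
  (fun t => `|2 * uval t - 1|) (cst 1)).
- by cont.
- by cont.
- by rewrite uval0 mulr0 sub0r normrN1.
- by rewrite uval1 mulr1 (_ : 2 - 1 = 1 :> R) ?normr1 //; lra.
- move=> t; rewrite [LHS]path_uval path_cat_clamp path_rev_clamp.
  case: ifP => h.
    by rewrite ler0_norm; [congr (p (clamp _)); lra|lra].
  by rewrite ger0_norm; [congr (p (clamp _)); lra|lra].
- by move=> t; rewrite path_clamp1.
Qed.

End paths.

Section fundamental_group.
Context (R : realType) {X : topologicalType} (x0 : X).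
Local Notation I := (unit_interval R).
Local Notation loop := {path I from x0 to x0 in X}.

Definition loop_rel (p q : loop) : bool := `[< path_homotopic p q >].

Fact loop_rel_refl : reflexive loop_rel.
Proof. by move=> p; apply/asboolP; exact: path_homotopic_refl. Qed.

Fact loop_rel_sym : symmetric loop_rel.
Proof. by move=> p q; apply/asboolP/asboolP; exact: path_homotopic_sym. Qed.

Fact loop_rel_trans : transitive loop_rel.
Proof.
move=> q p r /asboolP pq /asboolP qr; apply/asboolP.
exact: path_homotopic_trans pq qr.
Qed.

Canonical loop_equiv :=
  EquivRel loop_rel loop_rel_refl loop_rel_sym loop_rel_trans.

Definition pi1 : Type := {eq_quot loop_equiv}.

HB.instance Definition _ := Choice.on pi1.
HB.instance Definition _ := Quotient.on pi1.

Lemma pi1_eqP (p q : loop) : \pi_pi1 p = \pi_pi1 q <-> path_homotopic p q.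
Proof.
split=> [/eqquotP/asboolP //|pq]; apply/eqquotP; exact/asboolP.
Qed.

Lemma pi1_reprP (p : loop) : path_homotopic (repr (\pi_pi1 p)) p.
Proof. by apply/pi1_eqP; rewrite reprK. Qed.

Definition pi1_mul (a b : pi1) : pi1 := \pi_pi1 (path_cat (repr a) (repr b)).
Definition pi1_one : pi1 := \pi_pi1 (path_cst x0).
Definition pi1_inv (a : pi1) : pi1 := \pi_pi1 (path_rev (repr a)).

Lemma pi1_mulE (p q : loop) :
  pi1_mul (\pi_pi1 p) (\pi_pi1 q) = \pi_pi1 (path_cat p q).
Proof. by apply/pi1_eqP; apply: path_cat_homotopic; exact: pi1_reprP. Qed.

Lemma pi1_invE (p : loop) : pi1_inv (\pi_pi1 p) = \pi_pi1 (path_rev p).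
Proof. by apply/pi1_eqP; apply: path_rev_homotopic; exact: pi1_reprP. Qed.

Fact pi1_mulA : associative pi1_mul.
Proof.
elim/quotW=> p; elim/quotW=> q; elim/quotW=> r.
rewrite (pi1_mulE q r) (pi1_mulE p q) !pi1_mulE.
apply/pi1_eqP; exact: path_catA.
Qed.

Fact pi1_mul1 : left_id pi1_one pi1_mul.
Proof.
by elim/quotW=> p; rewrite pi1_mulE; apply/pi1_eqP; exact: path_cat1p.
Qed.

Fact pi1_mulr1 : right_id pi1_one pi1_mul.
Proof.
by elim/quotW=> p; rewrite pi1_mulE; apply/pi1_eqP; exact: path_catp1.
Qed.

Fact pi1_mulV : left_inverse pi1_one pi1_inv pi1_mul.
Proof.
elim/quotW=> p; rewrite pi1_invE pi1_mulE; apply/pi1_eqP.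
exact: path_rev_cat.
Qed.

Fact pi1_mulrV : right_inverse pi1_one pi1_inv pi1_mul.
Proof.
elim/quotW=> p; rewrite pi1_invE pi1_mulE; apply/pi1_eqP.
exact: path_cat_rev.
Qed.

HB.instance Definition _ := isGroup.Build pi1
  pi1_mulA pi1_mul1 pi1_mulr1 pi1_mulV pi1_mulrV.

End fundamental_group.

Section induced_homomorphism.
Context (R : realType) {X Y : topologicalType} (f : continuousType X Y).
Context (x0 : X).
Local Notation I := (unit_interval R).

Lemma comp_homotopic (p q : {path I from x0 to x0 in X}) :
  path_homotopic p q ->
  path_homotopic (f \o p : {path I from f x0 to f x0 in Y}) (f \o q).
Proof.
move=> [H [cH H0 H1 Hx Hy]]; exists (f \o H); split => /= [w|t|t|s|s].
- by apply: continuous_comp; [exact: cH|exact: cts_fun].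
- by rewrite H0.
- by rewrite H1.
- by rewrite Hx.
- by rewrite Hy.
Qed.

Definition pi1_map (a : pi1 R x0) : pi1 R (f x0) :=
  \pi_(pi1 R (f x0)) (f \o repr a : {path I from f x0 to f x0 in Y}).

Lemma pi1_mapE (p : {path I from x0 to x0 in X}) :
  pi1_map (\pi_(pi1 R x0) p) =
  \pi_(pi1 R (f x0)) (f \o p : {path I from f x0 to f x0 in Y}).
Proof. by apply/pi1_eqP; apply: comp_homotopic; exact: pi1_reprP. Qed.

Fact pi1_map_mul : {morph pi1_map : a b / (a * b)%g}.
Proof.
elim/quotW=> p; elim/quotW=> q.
rewrite (_ : (_ * _)%g = \pi_(pi1 R x0) (path_cat p q)); last exact: pi1_mulE.
rewrite !pi1_mapE [RHS]pi1_mulE.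
congr (\pi_(pi1 R (f x0)) _); apply/path_eqP => t.
by rewrite /path_cat /= /mk_path /= /path_cat_fun; case: ifP.
Qed.

Fact pi1_map_one : pi1_map 1%g = 1%g.
Proof.
rewrite [LHS]pi1_mapE; congr (\pi_(pi1 R (f x0)) _); exact/path_eqP.
Qed.

HB.instance Definition _ :=
  isUMagmaMorphism.Build (pi1 R x0) (pi1 R (f x0)) pi1_map
    (pi1_map_one, pi1_map_mul).

End induced_homomorphism.

Definition path_connected_set (R : realType) (X : topologicalType)
    (A : set X) : Prop :=
  forall x y, A x -> A y ->
    exists p : {path (unit_interval R) from x to y in X}, range p `<=` A.

Definition locally_path_connected (R : realType) (X : topologicalType) : Prop :=
  forall (x : X) (U : set X), nbhs x U ->
    exists V : set X, [/\ open_nbhs x V, V `<=` U & path_connected_set R V].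

(* The loops of U based at x are the loops of X based at x with range in U. *)
Definition semilocally_simply_connected (R : realType)
    (X : topologicalType) : Prop :=
  forall x : X, exists2 U : set X, nbhs x U &
    forall p : {path (unit_interval R) from x to x in X},
      range p `<=` U -> \pi_(pi1 R x) p = 1%g.

Definition homeomorphism (A B : topologicalType) (h : A -> B) : Prop :=
  continuous h /\
  exists g : B -> A, [/\ continuous g, cancel h g & cancel g h].

(* The family S of sheets may be empty, so a covering need not be surjective
   and its total space may be empty. *)
Definition evenly_covered (E Y : topologicalType) (p : E -> Y)
    (U : set Y) : Prop :=
  exists S : set (set E),
    [/\ forall V, S V -> open V,
        trivIset S id,
        p @^-1` U = \bigcup_(V in S) V
      & forall V, S V -> exists2 h : set_type V -> set_type U,
          homeomorphism h & forall e : set_type V, \val (h e) = p (\val e)].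

Definition is_covering (E Y : topologicalType) (p : E -> Y) : Prop :=
  continuous p /\
  forall y : Y, exists2 U : set Y, open_nbhs y U & evenly_covered p U.

Record covering (Y : topologicalType) := Covering {
  total : topologicalType ;
  proj : total -> Y ;
  coveringP : is_covering proj }.
Arguments proj {Y} _ _.

Record covering_hom (Y : topologicalType) (E1 E2 : covering Y) := CoveringHom {
  cov_fun :> total E1 -> total E2 ;
  cov_cts : continuous cov_fun ;
  cov_proj : proj E1 = proj E2 \o cov_fun }.

Section covering_category.
Context {Y : topologicalType}.
Implicit Types E : covering Y.

Lemma covering_hom_eq E1 E2 (t u : covering_hom E1 E2) : t =1 u -> t = u.
Proof.
case: t u => [t ct pt] [u cu pu] /= /funext tu; rewrite -{}tu in cu pu *.
by rewrite (Prop_irrelevance cu ct) (Prop_irrelevance pu pt).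
Qed.

Definition covering_id E : covering_hom E E :=
  @CoveringHom Y E E idfun (fun e => cvg_id) erefl.

Fact covering_comp_cts E1 E2 E3 (u : covering_hom E2 E3)
  (t : covering_hom E1 E2) : continuous (u \o t).
Proof. by move=> e; apply: continuous_comp; exact: cov_cts. Qed.

Fact covering_comp_proj E1 E2 E3 (u : covering_hom E2 E3)
  (t : covering_hom E1 E2) : proj E1 = proj E3 \o (u \o t).
Proof. by rewrite (cov_proj t) (cov_proj u). Qed.

Definition covering_comp E1 E2 E3 (u : covering_hom E2 E3)
    (t : covering_hom E1 E2) : covering_hom E1 E3 :=
  CoveringHom (@covering_comp_cts _ _ _ u t) (covering_comp_proj u t).

Fact covering_comp1m E1 E2 (t : covering_hom E1 E2) :
  covering_comp (covering_id E2) t = t.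
Proof. exact: covering_hom_eq. Qed.

Fact covering_compm1 E1 E2 (t : covering_hom E1 E2) :
  covering_comp t (covering_id E1) = t.
Proof. exact: covering_hom_eq. Qed.

Fact covering_compA E1 E2 E3 E4 (t : covering_hom E1 E2)
    (u : covering_hom E2 E3) (v : covering_hom E3 E4) :
  covering_comp v (covering_comp u t) = covering_comp (covering_comp v u) t.
Proof. exact: covering_hom_eq. Qed.

End covering_category.

Definition Cov (Y : topologicalType) : category :=
  Category (@covering_comp1m Y) (@covering_compm1 Y) (@covering_compA Y).

Section pullback.
Context {X Y : topologicalType} (f : continuousType X Y).

Definition pullback_set (E : covering Y) : set (X * total E) :=
  [set xe | f xe.1 = proj E xe.2].
Arguments pullback_set : clear implicits.

Definition pullback_total (E : covering Y) : topologicalType :=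
  set_type (pullback_set E).

Definition pullback_proj (E : covering Y) (w : pullback_total E) : X :=
  (\val w).1.

Lemma pullback_val_cts (E : covering Y) :
  continuous (fun w : pullback_total E => \val w).
Proof. exact: (@initial_continuous _ (X * total E)%type set_val). Qed.

Lemma pullback_snd_cts (E : covering Y) :
  continuous (fun w : pullback_total E => (\val w).2).
Proof. exact: cont_comp (@pullback_val_cts E) (@cont_snd _ _). Qed.

Lemma pullback_proj_cts (E : covering Y) : continuous (@pullback_proj E).
Proof. exact: cont_comp (@pullback_val_cts E) (@cont_fst _ _). Qed.

Fact pullback_sheet (E : covering Y) (U : set Y) (V : set (total E)) :
  (exists2 h : set_type V -> set_type U,
    homeomorphism h & forall e, \val (h e) = proj E (\val e)) ->
  exists2 h : set_type [set w : pullback_total E | V (\val w).2] ->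
      set_type (f @^-1` U),
    homeomorphism h & forall w, \val (h w) = pullback_proj (\val w).
Proof.
move=> [h [ch [g [cg hK gK]]] hp].
have fw (w : set_type [set w : pullback_total E | V (\val w).2]) :
    (\val (\val w)).1 \in f @^-1` U.
  apply/mem_set => /=; have /= -> := set_valP (\val w).
  have /= Vw := set_valP w.
  rewrite -(hp (exist (fun e => e \in V) _ (mem_set Vw))).
  exact: (set_valP (h _)).
pose k w : set_type (f @^-1` U) := exist (fun x => x \in f @^-1` U) _ (fw w).
have gx (x : set_type (f @^-1` U)) : f (\val x) \in U.
  by apply/mem_set; exact: (set_valP x).
pose fx (x : set_type (f @^-1` U)) : set_type U :=
  exist (fun y => y \in U) _ (gx x).
have wx (x : set_type (f @^-1` U)) :
    (\val x, \val (g (fx x))) \in pullback_set E.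
  by apply/mem_set; rewrite /pullback_set /= -hp gK.
pose w0 x : pullback_total E := exist (fun v => v \in pullback_set E) _ (wx x).
have Vx x : w0 x \in [set w : pullback_total E | V (\val w).2].
  by apply/mem_set => /=; exact: (set_valP (g _)).
exists k; last by [].
split.
  apply: (@continuous_comp_initial _ _ _ set_val).
  exact: cont_comp (@initial_continuous _ _ set_val) (@pullback_proj_cts E).
exists (fun x =>
  exist (fun w => w \in [set w : pullback_total E | V (\val w).2]) _ (Vx x)).
split.
- apply: (@continuous_comp_initial _ _ _ set_val).
  apply: (@continuous_comp_initial _ _ _ set_val).
  apply: continuous_pair.
    exact: (@initial_continuous _ _ set_val).
  have cfx : continuous fx.
    apply: (@continuous_comp_initial _ _ _ set_val).
    exact: cont_comp (@initial_continuous _ _ set_val) (@cts_fun _ _ f).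
  apply: cont_comp (@initial_continuous _ _ set_val).
  exact: cont_comp cfx cg.
- move=> w; do 2 apply: val_inj => /=.
  have /= Vw := set_valP w; pose e : set_type V := exist (fun e => e \in V) _ (mem_set Vw).
  rewrite (_ : fx (k w) = h e) ?hK /=; first by case: (\val (\val w)).
  by apply: val_inj; rewrite hp /=; exact: (set_valP (\val w)).
- by move=> x; exact: val_inj.
Qed.

Fact pullback_is_covering (E : covering Y) : is_covering (@pullback_proj E).
Proof.
split=> [|x]; first exact: pullback_proj_cts.
have [_ /(_ (f x))[U [oU Ufx] [S [So Sd SU Sh]]]] := coveringP E.
exists (f @^-1` U).
  by split => //; move/continuousP: (@cts_fun _ _ f); exact.
exists [set A | exists2 V, S V & A = [set w | V (\val w).2]]; split.
- move=> _ [V SV ->].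
  by move/continuousP: (@pullback_snd_cts E); apply; exact: So.
- move=> _ _ [V SV ->] [W SW ->] [w /= [Vw Ww]].
  by rewrite (Sd V W SV SW) //; exists (\val w).2.
- have SUE e : U (proj E e) = (\bigcup_(V in S) V) e by rewrite -SU.
  apply/seteqP; split => w; have /= fw := set_valP w.
    rewrite /= /pullback_proj fw SUE => -[V SV Vw].
    by exists [set w | V (\val w).2] => //; exists V.
  move=> [_ [V SV ->]] /= Vw; rewrite /pullback_proj fw SUE.
  by exists V.
- by move=> _ [V SV ->]; exact/pullback_sheet/Sh.
Qed.

Definition pullback (E : covering Y) : covering X :=
  Covering (pullback_is_covering E).

Section pullback_map.
Context (E1 E2 : covering Y) (t : covering_hom E1 E2).

Fact pullback_fun_subproof (w : pullback_total E1) :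
  ((\val w).1, t (\val w).2) \in pullback_set E2.
Proof.
apply/mem_set; have := set_valP w; rewrite /pullback_set /= => ->.
exact: (congr1 (@^~ (\val w).2) (cov_proj t)).
Qed.

Definition pullback_fun (w : pullback_total E1) : pullback_total E2 :=
  exist (fun v => v \in pullback_set E2) _ (pullback_fun_subproof w).

Fact pullback_fun_cts : continuous pullback_fun.
Proof.
apply: (@continuous_comp_initial _ _ _ set_val).
apply: continuous_pair; first exact: pullback_proj_cts.
exact: cont_comp (@pullback_snd_cts E1) (@cov_cts _ _ _ t).
Qed.

Fact pullback_fun_proj :
  @pullback_proj E1 = @pullback_proj E2 \o pullback_fun.
Proof. by []. Qed.

Definition pullback_map : covering_hom (pullback E1) (pullback E2) :=
  @CoveringHom X (pullback E1) (pullback E2) pullback_fun pullback_fun_cts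
    pullback_fun_proj.

End pullback_map.

Fact pullback_map_id (E : covering Y) :
  pullback_map (covering_id E) = covering_id (pullback E).
Proof.
by apply: covering_hom_eq => w; apply: val_inj => /=; case: (\val w).
Qed.

Fact pullback_map_comp (E1 E2 E3 : covering Y) (u : covering_hom E2 E3)
    (t : covering_hom E1 E2) :
  pullback_map (covering_comp u t) =
  covering_comp (pullback_map u) (pullback_map t).
Proof. by apply: covering_hom_eq => w; exact: val_inj. Qed.

Definition pullback_functor : functor (Cov Y) (Cov X) :=
  @Functor (Cov Y) (Cov X) pullback pullback_map
    pullback_map_id pullback_map_comp.

End pullback.

(* Main.v *)
(* A covering of a connected, locally path-connected space is determined by
   its fibre over a base point with the monodromy action of the fundamental
   group, and the fibre of the pullback [f^*E] over [x0] is the fibre of [E]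
   over [f x0] on which loops act through [f]. If [pi1_map f] is surjective, a
   bijection of fibres commuting with the loops of [X] thus commutes with all
   loops of [Y]. Otherwise let [H] be the image of [pi1_map f] in
   [G := pi1 R (f x0)]. There is a right [G]-set [A] without [G]-fixed point
   such that [A] and [option A] become isomorphic when restricted to [H];
   semilocal simple connectedness of [Y] realizes both as fibres of coverings,
   which are then not isomorphic but have isomorphic pullbacks. *)
Require Import Defs.
From HB Require Import structures.
From mathcomp Require Import all_boot all_order all_algebra generic_quotient.
From mathcomp Require Import boolp classical_sets functions set_interval.
From mathcomp Require Import lra.
From mathcomp Require Import reals topology normedtype homotopy.

Set Implicit Arguments.
Unset Strict Implicit.
Unset Printing Implicit Defensive.

Import Order.TTheory GRing.Theory Num.Theory.
Import numFieldTopology.Exports numFieldNormedType.Exports.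

Local Open Scope classical_set_scope.
Local Open Scope ring_scope.
Local Open Scope quotient_scope.

(** * Induction on the half-line and connectedness *)

(** The supremum of the points of [[0, c]] where [P] holds has a neighbourhood in which [P]
    propagates upwards, so it cannot lie below [c]. This takes the place of subdividing a compact
    interval when lifting along a covering. *)
Lemma real_induction (R : realType) (P : R -> Prop) :
  (forall t, exists2 e : R, 0 < e & forall a b, 0 <= a -> a <= b ->
    `|a - t| < e -> `|b - t| < e -> P a -> P b) ->
  P 0 -> forall t, 0 <= t -> P t.
Proof.
move=> step P0 c c0.
pose S := [set t | [/\ 0 <= t, t <= c & P t]].
have S0 : S 0 by [].
have hS : has_sup S by split; [exists 0|exists c => t []].
set t := sup S.
have [e e0 he] := step t.
have [a [a0 ac Pa] ta] := sup_adherent e0 hS.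
have at_ : a <= t by apply: ub_le_sup => //; exact: hS.2.
have tc : t <= c by apply: ge_sup; [exists 0|move=> x []].
have P' b : a <= b -> b < t + e -> P b.
  move=> ab bt; apply: (he a b) => //; rewrite ltr_norml; apply/andP; split.
  - by rewrite -/t in ta; lra.
  - lra.
  - by rewrite -/t in ta; lra.
  - lra.
have [tc'|tc'] := ltP t c; last by apply: P'; lra.
have : S (Num.min c (t + e / 2)).
  split; first by rewrite le_min; lra.
  - by rewrite ge_min lexx.
  - apply: P'; first by rewrite le_min; lra.
    by rewrite gt_min; apply/orP; right; lra.
move=> /(ub_le_sup hS.2); rewrite -/t ge_min => /orP[]; lra.
Qed.

Lemma connected_clopen (T : topologicalType) (A : set T) :
  connected [set: T] -> A !=set0 -> open A -> open (~` A) -> A = setT.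
Proof.
move=> cT A0 oA oA'; apply: cT => //; first by exists A; rewrite ?setTI.
by exists A; rewrite ?setTI // -[A]setCK; exact: open_closedC.
Qed.

Lemma openP (T : topologicalType) (A : set T) :
  (forall x, A x -> nbhs x A) -> open A.
Proof. by move=> h; rewrite openE => x /h. Qed.

Lemma nbhs_preimage (T U : topologicalType) (f : T -> U) (x : T) (A : set U) :
  {for x, continuous f} -> nbhs (f x) A -> nbhs x (f @^-1` A).
Proof. by move=> cf /cf. Qed.

(** * Lifting paths and homotopies *)

Section trivialization.
Context {E Y : topologicalType} (p : E -> Y).

(* [s e] is the section over [U] whose image is the sheet containing [e]; its
   values are irrelevant outside [U] and when [p e] is not in [U]. *)
Record section_family (U : set Y) (s : E -> Y -> E) : Prop := SectionFamily {
  sectionK : forall e z, U (p e) -> U z -> p (s e z) = z ;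
  section_self : forall e, U (p e) -> s e (p e) = e ;
  section_cts : forall e z, U (p e) -> U z -> {for z, continuous (s e)} ;
  section_section : forall e z w, U (p e) -> U z -> U w ->
    s (s e z) w = s e w ;
  section_nbhs : forall e, U (p e) ->
    nbhs e [set e' | U (p e') /\ s e (p e') = e'] }.

(** Each sheet maps bijectively to [U], so [s e z] can be the point over [z] in the sheet of [e].
    Continuity comes from the inverse homeomorphism of the sheet, and [section_nbhs] from the sheet
    being open. *)
Lemma is_covering_sections (y : Y) : is_covering p ->
  exists U s, open_nbhs y U /\ section_family U s.
Proof.
move=> [_ /(_ y)[U Uy [S [So Sd SU Sh]]]].
have dS V W e : S V -> S W -> V e -> W e -> V = W.
  by move=> SV SW Ve We; apply: Sd => //; exists e.
have VU V e : S V -> V e -> U (p e).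
  by move=> SV Ve; rewrite -[U (p e)]/((p @^-1` U) e) SU; exists V.
have UV e : U (p e) -> exists2 V, S V & V e.
  by rewrite -[U (p e)]/((p @^-1` U) e) SU => -[V]; exists V.
have inj V e e' : S V -> V e -> V e' -> p e = p e' -> e = e'.
  move=> SV Ve Ve' ee'; have [h [_ [g [_ hK _]]] hp] := Sh V SV.
  pose v : set_type V := exist (fun e => e \in V) e (mem_set Ve).
  pose v' : set_type V := exist (fun e => e \in V) e' (mem_set Ve').
  have : h v = h v' by apply: val_inj; rewrite !hp.
  by move=> /(can_inj hK)/(congr1 val).
have sur V z : S V -> U z -> exists2 e, V e & p e = z.
  move=> SV Uz; have [h [_ [g [_ _ gK]]] hp] := Sh V SV.
  pose v : set_type U := exist (fun e => e \in U) z (mem_set Uz).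
  by exists (val (g v)); [exact: (set_valP (g v))|rewrite -hp gK].
pose same e e' := exists2 V, S V & V e /\ V e'.
pose s e z := xget e [set e' | same e e' /\ p e' = z].
have sP e z : U (p e) -> U z -> same e (s e z) /\ p (s e z) = z.
  move=> Ue Uz; have [V SV Ve] := UV e Ue; have [e' Ve' e'z] := sur V z SV Uz.
  rewrite /s; case: xgetP => [x -> //|/(_ e')[]]; split => //.
  by exists V.
have sV V e z : S V -> V e -> U z -> V (s e z) /\ p (s e z) = z.
  move=> SV Ve Uz; have [[W SW [We Ws]] ->] := sP e z (VU _ _ SV Ve) Uz.
  by rewrite (dS V W e).
exists U, s; split => //; split.
- by move=> e z Ue Uz; have [] := sP e z Ue Uz.
- move=> e Ue; have [V SV Ve] := UV e Ue.
  by have [Vs ps] := sV V e (p e) SV Ve Ue; exact: (inj V).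
- move=> e z Ue Uz; have [V SV Ve] := UV e Ue.
  have [h [_ [g [cg hK gK]]] hp] := Sh V SV.
  pose v : set_type U := exist (fun e => e \in U) z (mem_set Uz).
  have gs x : s e (val x) = val (g x).
    have [Vs ps] := sV V e (val x) SV Ve (set_valP x).
    by apply: (inj V) => //; [exact: (set_valP (g x))|rewrite ps -hp gK].
  have cg' : continuous (val \o g).
    exact: cont_comp cg (@initial_continuous _ _ set_val).
  move=> W; rewrite /= -[z]/(val v) gs => /(cg' v)[_ [[O oO <-] Ov OW]].
  rewrite nbhs_simpl /=; apply: filterS (open_nbhs_nbhs (conj (openI oO Uy.1) _)).
    move=> w [Ow Uw].
    pose u : set_type U := exist (fun e => e \in U) w (mem_set Uw).
    by rewrite /= -[w]/(val u) gs; apply: (OW u).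
  by split.
- move=> e z w Ue Uz Uw; have [V SV Ve] := UV e Ue.
  have [Vz _] := sV V e z SV Ve Uz.
  have [Vw pw] := sV V e w SV Ve Uw.
  have [Vzw pzw] := sV V _ w SV Vz Uw.
  by apply: (inj V) => //; rewrite pw.
- move=> e Ue; have [V SV Ve] := UV e Ue.
  apply: filterS (open_nbhs_nbhs (conj (So V SV) Ve)) => e' Ve'.
  have Ue' := VU _ _ SV Ve'; split=> //.
  by have [Vs ps] := sV V e _ SV Ve Ue'; exact: (inj V).
Qed.

Lemma section_sym U s e e' : section_family U s -> U (p e) -> U (p e') ->
  s e (p e') = e' -> s e' (p e) = e.
Proof.
move=> sf Ue Ue' <-.
by rewrite (section_section sf) // (section_self sf).
Qed.

(** The set of agreement is clopen. Near [z] both lifts follow sections over a common [U]. Sections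
    that agree at one point of [U] agree on all of it, so agreement at [z] spreads to nearby points,
    and agreement at a nearby point carries back to [z]. *)
Lemma lift_unique (Z : topologicalType) (a b : Z -> E) : is_covering p ->
  connected [set: Z] -> continuous a -> continuous b -> p \o a =1 p \o b ->
  forall z0, a z0 = b z0 -> a =1 b.
Proof.
move=> cp cZ ca cb ab z0 ab0.
suff /seteqP[_ h] : [set z | a z = b z] = setT by move=> z; exact: h.
apply: connected_clopen => //; first by exists z0.
- apply: openP => z /= abz.
  have [U [s [Uz sf]]] := is_covering_sections (p (a z)) cp.
  have N := section_nbhs sf Uz.2; have N' := N; rewrite abz in N'.
  have Na := nbhs_preimage (ca z) N; have Nb := nbhs_preimage (cb z) N'.
  apply: filterS (filterI Na Nb) => w /= [[_ aw] [_ bw]].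
  by rewrite -aw -bw abz; have /= -> := ab w.
- apply: openP => z /= abz.
  have [U [s [Uz sf]]] := is_covering_sections (p (a z)) cp.
  have Ub : U (p (b z)) by have /= <- := ab z; exact: Uz.2.
  have Na := nbhs_preimage (ca z) (section_nbhs sf Uz.2).
  have Nb := nbhs_preimage (cb z) (section_nbhs sf Ub).
  apply: filterS (filterI Na Nb) => w /= [[Ua aw] [Uw bw]] abw; apply: abz.
  have := ab z; rewrite /= => pz.
  rewrite -[LHS](section_sym sf _ _ aw) //; last exact: Uz.2.
  by rewrite abw pz (section_sym sf _ _ bw).
Qed.

End trivialization.

Section homotopy_lifting.
Context {R : realType} {E Y : topologicalType} (p : E -> Y).
Hypothesis cp : is_covering p.

(** The retraction of the line onto [[c - d, c + d]]. Precomposing with it lets a lift over a strip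
    be a map on the whole plane, which avoids subspaces. *)
Definition window (c d z : R) : R := Num.max (c - d) (Num.min z (c + d)).

Lemma window_id c d z : `|z - c| <= d -> window c d z = z.
Proof.
rewrite ler_norml => /andP[h1 h2]; rewrite /window.
by rewrite (min_idPl _) ?(max_idPr _) //; lra.
Qed.

Lemma window_dist c d z : 0 <= d -> `|window c d z - c| <= d.
Proof.
move=> d0; rewrite ler_norml /window.
have h1 : c - d <= Num.max (c - d) (Num.min z (c + d)) by rewrite le_max lexx.
have h2 : Num.max (c - d) (Num.min z (c + d)) <= c + d.
  by rewrite ge_max ge_min lexx orbT andbT; lra.
by apply/andP; split; lra.
Qed.

Lemma continuous_window c d : continuous (window c d).
Proof.
apply: contmax; first exact: contC.
by apply: contmin; [exact: cont_id|exact: contC].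
Qed.

(** Induction on the height [t] reached by the lift. One evenly covered set contains the homotopy
    near [(c, t)], so a lift up to a height [a] near [t] extends through a section, at the price of
    a narrower strip. Above height [t] the homotopy is frozen. *)
Lemma homotopy_lift_local (H : R * R -> Y) (e : E) (c t : R) :
  continuous H -> (forall z r, r <= 0 -> H (z, r) = p e) -> 0 <= t ->
  exists2 d : R, 0 < d & exists q : R * R -> E,
    [/\ continuous q, forall z r, r <= 0 -> q (z, r) = e &
      forall z r, p (q (z, r)) = H (window c d z, Num.min r t)].
Proof.
move=> cH H0 t0; move: t t0; apply: real_induction; last first.
  exists 1 => //; exists (cst e); split => //; first exact: cst_continuous.
  by move=> z r; rewrite H0 // ge_min lexx orbT.
move=> t; have [U [s [Uy sf]]] := is_covering_sections (H (c, t)) cp.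
have := nbhs_preimage (cH (c, t)) (open_nbhs_nbhs Uy).
move=> [[A B] /= [/nbhs_ballP[e1 /= e10 hA] /nbhs_ballP[e2 /= e20 hB]] hAB].
have HU z r : `|z - c| < e1 -> `|r - t| < e2 -> U (H (z, r)).
  move=> ze re; apply: (hAB (z, r)); split => /=.
    by apply: hA; rewrite /ball /= distrC.
  by apply: hB; rewrite /ball /= distrC.
exists e2 => // a b a0 ab ae be [d d0 [q [cq q0 qH]]].
have pqa : p (q (c, a)) = H (c, a).
  by rewrite qH minxx window_id // subrr normr0 ltW.
have Ue : U (p (q (c, a))) by rewrite pqa; apply: HU => //; rewrite subrr normr0.
have cqa : continuous (fun z => q (z, a)).
  by apply: continuous_comp2 => //; [exact: cont_id|exact: contC].
have /nbhs_ballP[d1 /= d10 hd1] := nbhs_preimage (cqa c) (section_nbhs sf Ue).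
(* The bound [d] keeps the old lift valid, [e1 / 2] keeps the homotopy in [U], and [d1 / 2] keeps
   the curve [q (_, a)] in the sheet of [q (c, a)], so that the old and new pieces agree at height
   [a]. *)
pose d' := Num.min d (Num.min (e1 / 2) (d1 / 2)).
have d'0 : 0 < d' by rewrite /d' !lt_min d0 !divr_gt0.
have d'd : d' <= d by rewrite /d' ge_min lexx.
have d'e1 : d' < e1.
  rewrite /d' gt_min; apply/orP; right; rewrite gt_min; apply/orP; left.
  by rewrite ltr_pdivrMr // ltr_pMr // ltr1n.
have d'd1 : d' < d1.
  rewrite /d' gt_min; apply/orP; right; rewrite gt_min; apply/orP; right.
  by rewrite ltr_pdivrMr // ltr_pMr // ltr1n.
pose W := window c d'.
have Wd z : `|W z - c| <= d' by apply: window_dist; exact: ltW.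
have cW : continuous W by exact: continuous_window.
have cW1 : continuous (fun w : R * R => W w.1).
  exact: cont_comp (@cont_fst _ _) cW.
have cl r : a <= Num.max a (Num.min r b) <= b.
  by rewrite le_max lexx /= ge_max ab ge_min lexx orbT.
have clU z r : U (H (W z, Num.max a (Num.min r b))).
  apply: HU; first exact: le_lt_trans (Wd z) _.
  have /andP[h1 h2] := cl r; move: ae be; rewrite !ltr_norml => /andP[? ?] /andP[? ?].
  by apply/andP; split; lra.
exists d' => //.
(* Pasting requires both branches to be continuous on the whole plane. Hence the second one clamps
   the height to [[a, b]], which keeps its values of [H] in [U]. *)
exists (fun w => if w.2 <= a then q (W w.1, w.2)
  else s (q (c, a)) (H (W w.1, Num.max a (Num.min w.2 b)))); split.
- apply: continuous_paste.
  + exact: cont_snd.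
  + by apply: continuous_comp2 => //; exact: cont_snd.
  + move=> w; apply: (@continuous_comp _ _ _
      (fun w : R * R => H (W w.1, Num.max a (Num.min w.2 b))) (s (q (c, a)))).
      apply: continuous_comp2 => //; apply: contmax; first exact: contC.
      by apply: contmin; [exact: cont_snd|exact: contC].
    by apply: (section_cts sf) => //; exact: clU.
  + move=> [z r] /= ->; rewrite (min_idPl ab) maxxx.
    have /hd1 /= [_] : ball c d1 (W z).
      by rewrite /ball /= distrC (le_lt_trans (Wd z)).
    by rewrite qH minxx window_id ?(le_trans (Wd z)).
- move=> z r r0 /=; rewrite (le_trans r0 a0) q0 //.
- move=> z r /=; case: (leP r a) => ra.
    rewrite qH window_id ?(le_trans (Wd z)) // (min_idPl ra).
    by rewrite (min_idPl (le_trans ra ab)).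
  rewrite (sectionK sf) //; congr (H (_, _)); apply/max_idPr.
  by rewrite le_min ab ltW.
Qed.

End homotopy_lifting.

Section lifts.
Context {R : realType} {E Y : topologicalType} (p : E -> Y).
Local Notation I := (unit_interval R).

Definition lifts (x y : Y) (w : {path I from x to y in Y}) (e e' : E) : Prop :=
  exists q : {path I from e to e' in E}, forall t, p (q t) = w t.

Lemma lifts_proj x y (w : {path I from x to y in Y}) e e' :
  lifts w e e' -> p e = x /\ p e' = y.
Proof.
move=> [q qw]; split.
  by rewrite -(path_zero (s := q)) qw (path_zero (s := w)).
by rewrite -(path_one (s := q)) qw (path_one (s := w)).
Qed.

(** Extending lifts to the real line, constantly beyond the ends of the path, puts them in the
    setting of the planar lifting lemma. *)
Lemma liftsP x y (w : {path I from x to y in Y}) e e' :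
  lifts w e e' <-> exists q : R -> E,
    [/\ continuous q, q 0 = e, q 1 = e' & forall r, p (q r) = w (clamp r)].
Proof.
split=> [[q qw]|[q [cq q0 q1 qw]]].
  exists (q \o clamp); split => [||//|r] /=.
  - exact: continuous_path_clamp (@cont_id _).
  - exact: (path_zero (s := q)).
  - exact: (path_one (s := q)).
  - exact: qw.
have cq' : continuous (q \o uval : I -> E).
  exact: cont_comp (@uval_continuous R) cq.
have h0 : (q \o uval) (zero : I) = e by rewrite /= uval0.
have h1 : (q \o uval) (one : I) = e' by rewrite /= uval1.
exists (mk_path cq' h0 h1) => t.
by rewrite /mk_path /= qw uvalK.
Qed.

Hypothesis cp : is_covering p.

Lemma real_connected : connected [set: R].
Proof. by apply/connected_intervalP => x y _ _ z _. Qed.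

Lemma real_lift_unique (a b : R -> E) : continuous a -> continuous b ->
  (forall r, p (a r) = p (b r)) -> a 0 = b 0 -> a 1 = b 1.
Proof.
by move=> ca cb ab ab0; exact: (lift_unique cp real_connected ca cb ab ab0).
Qed.

Lemma lifts_unique x y (w : {path I from x to y in Y}) e e1 e2 :
  lifts w e e1 -> lifts w e e2 -> e1 = e2.
Proof.
move=> /liftsP[a [ca a0 <- aw]] /liftsP[b [cb b0 <- bw]].
by apply: real_lift_unique => // [r|]; rewrite ?aw ?bw ?a0.
Qed.

(** A path is a homotopy that does not depend on its stage. The lift is the column over stage
    [0]. *)
Lemma lifts_exists x y (w : {path I from x to y in Y}) e :
  p e = x -> exists e', lifts w e e'.
Proof.
move=> ex.
have [|z r r0|d _ [q [cq q0 qw]]] := homotopy_lift_local cp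
    (H := fun u : R * R => w (clamp u.2)) (e := e) 0 _ _ (@ler01 R).
- exact: continuous_path_clamp (@cont_snd _ _).
- by rewrite ex path_clamp0.
exists (q (0, 1)); apply/liftsP; exists (fun r => q (0, r)); split => //.
- by apply: continuous_comp2 => //; [exact: contC|exact: cont_id].
- exact: q0.
- move=> r; rewrite qw /=; case: (leP r 1) => // r1.
  by rewrite (clamp1 (ltW r1)).
Qed.

Lemma lifts_cst x e : p e = x -> lifts (path_cst x) e e.
Proof. by move=> ex; exists (path_cst e) => t; rewrite /= ex. Qed.

Lemma lifts_cat x y z (w : {path I from x to y in Y})
    (w' : {path I from y to z in Y}) e e' e'' :
  lifts w e e' -> lifts w' e' e'' -> lifts (path_cat w w') e e''.
Proof.
move=> [q qw] [q' qw']; exists (path_cat q q') => t.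
by rewrite /path_cat /= /mk_path /= /path_cat_fun; case: ifP.
Qed.

Lemma lifts_rev x y (w : {path I from x to y in Y}) e e' :
  lifts w e e' -> lifts (path_rev w) e' e.
Proof.
move=> [q qw]; exists (path_rev q) => t.
by rewrite /path_rev /= /mk_path /= /path_rev_fun.
Qed.

Lemma path_revK x y (w : {path I from x to y in Y}) : path_rev (path_rev w) = w.
Proof.
apply/path_eqP => t; rewrite [in RHS]path_uval -[in LHS](uvalK t) !path_rev_clamp.
by congr (w (clamp _)); lra.
Qed.

(* The lifts of the stages of a homotopy starting at a given point all end at
   the same point, since over a short range of stages the endpoints form a
   continuous curve in a fibre, which is constant by unique lifting. *)
Lemma lifts_homotopic x y (w w' : {path I from x to y in Y}) e e' :
  path_homotopic w w' -> lifts w e e' -> lifts w' e e'.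
Proof.
move=> [G [cG G0 G1 Gx Gy]] we.
have ex : p e = x := (lifts_proj we).1.
pose H (u : R * R) := G (clamp u.1, clamp u.2).
have cH : continuous H.
  apply: continuous_comp2 => //.
    exact: continuous_clamp (@cont_fst _ _).
  exact: continuous_clamp (@cont_snd _ _).
have Hx z r : r <= 0 -> H (z, r) = p e.
  by move=> r0; rewrite /H /= (clamp0 r0) -/zero Gx.
pose P z := exists q : R -> E,
  [/\ continuous q, q 0 = e, q 1 = e' & forall r, p (q r) = H (z, r)].
suff : P 1.
  move=> [q [cq q0 q1 qH]]; apply/liftsP; exists q; split => // r.
  by rewrite qH -G1.
move: (@ler01 R); apply: (@real_induction _ P); last first.
  have /liftsP[q [cq q0 q1 qw]] := we.
  by exists q; split => // r; rewrite qw -G0.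
move=> t; have [d d0 [q [cq q0 qH]]] := homotopy_lift_local cp t cH Hx (@ler01 R).
have qH' z r : `|z - t| < d -> p (q (z, r)) = H (z, r).
  move=> zt; rewrite qH window_id ?ltW //; case: (leP r 1) => // r1.
  by rewrite /H /= (clamp1 (ltW r1)).
have cqz z : continuous (fun r => q (z, r)).
  by apply: continuous_comp2 => //; [exact: contC|exact: cont_id].
exists d => // a b _ _ ad bd [a' [ca' a'0 a'1 a'H]].
exists (fun r => q (b, r)); split; [exact: cqz|exact: q0| |by move=> r; exact: qH'].
rewrite -a'1; transitivity (q (a, 1)).
  apply: (lift_unique cp real_connected (a := fun z => q (z, 1))
    (b := fun _ => q (a, 1)) _ _ _ (z0 := a)) => //.
  - by apply: continuous_comp2 => //; [exact: cont_id|exact: contC].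
  - exact: cst_continuous.
  - by move=> z /=; rewrite !qH /H /= minxx !Gy.
apply: (real_lift_unique (a := fun r => q (a, r))) => // [r|].
  by rewrite qH' // a'H.
by rewrite a'0 q0.
Qed.

Lemma lifts_section U s x y (w : {path I from x to y in Y}) e :
  section_family p U s -> range w `<=` U -> p e = x -> lifts w e (s e y).
Proof.
move=> sf wU ex.
have wU' t : U (w t) by apply: wU; exists t.
have Ux : U x by rewrite -(path_zero (s := w)).
have Ue : U (p e) by rewrite ex.
have cq : continuous (s e \o w).
  move=> t; apply: continuous_comp; first exact: cts_fun.
  exact: (section_cts sf).
have h0 : (s e \o w) (zero : I) = e.
  by rewrite /= (path_zero (s := w)) -ex (section_self sf).
have h1 : (s e \o w) (one : I) = s e y by rewrite /= (path_one (s := w)).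
exists (mk_path cq h0 h1) => t.
by rewrite /mk_path /= (sectionK sf).
Qed.

End lifts.

Lemma lifts_hom (R : realType) (Y : topologicalType) (E1 E2 : covering Y)
    (t : covering_hom E1 E2) (x y : Y)
    (w : {path (unit_interval R) from x to y in Y}) e e' :
  lifts (proj E1) w e e' -> lifts (proj E2) w (t e) (t e').
Proof.
move=> /liftsP[q [cq <- <- qw]]; apply/liftsP; exists (t \o q); split => //.
  exact: cont_comp cq (@cov_cts _ _ _ t).
by move=> r; rewrite -qw (cov_proj t).
Qed.

(** * Coverings and their fibres *)

Lemma connected_path (R : realType) (X : topologicalType) (x y : X) :
  connected [set: X] -> locally_path_connected R X ->
  inhabited {path (unit_interval R) from x to y in X}.
Proof.
move=> cX lX.
suff /seteqP[_ h] : [set y | inhabited {path (unit_interval R) from x to y in X}]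
  = setT by exact: h.
apply: connected_clopen => //; first by exists x; exists; exact: path_cst.
- apply: openP => z [w]; have [V [Vz _ pV]] := lX z setT filterT.
  apply: filterS (open_nbhs_nbhs Vz) => z' Vz'.
  have [w' _] := pV z z' Vz.2 Vz'.
  by exists; exact: path_cat w w'.
- apply: openP => z nz; have [V [Vz _ pV]] := lX z setT filterT.
  apply: filterS (open_nbhs_nbhs Vz) => z' Vz' [w]; apply: nz.
  have [w' _] := pV z' z Vz' Vz.2.
  by exists; exact: path_cat w w'.
Qed.

Section fibre_relation.
Context (R : realType) (Y : topologicalType) (x0 : Y).
Context (connY : connected [set: Y]) (lpcY : locally_path_connected R Y).
Local Notation I := (unit_interval R).

(** Every point of [E1] is the end of a lifted path that starts over [x0], and morphisms carry lifts
    to lifts. *)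
Lemma covering_hom_unique (E1 E2 : covering Y) (t u : covering_hom E1 E2) :
  (forall e, proj E1 e = x0 -> t e = u e) -> t = u.
Proof.
move=> tu; apply: covering_hom_eq => e.
have [w] := connected_path (proj E1 e) x0 connY lpcY.
have [e0 we0] := lifts_exists (coveringP E1) w (erefl _).
have e0x := (lifts_proj we0).2.
have we := lifts_rev we0.
have h := lifts_hom u we; rewrite -tu // in h.
exact: (lifts_unique (coveringP E2) (lifts_hom t we) h).
Qed.

(** An equivariant map of fibres over [x0], encoded as a relation on total spaces. The fibre then
    needs no type of its own, and an inverse is obtained by swapping the arguments. *)
Variant fibre_map (E1 E2 : covering Y)
    (Phi : Defs.total E1 -> Defs.total E2 -> Prop) : Prop := FibreMap of
  (forall e, proj E1 e = x0 -> exists e', Phi e e') &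
  (forall e e', Phi e e' -> proj E1 e = x0 /\ proj E2 e' = x0) &
  (forall e e1 e2, Phi e e1 -> Phi e e2 -> e1 = e2) &
  (forall (w : {path I from x0 to x0 in Y}) e e' d d',
    Phi e e' -> lifts (proj E1) w e d -> lifts (proj E2) w e' d' -> Phi d d').

(* The extension of [Phi] maps e to the end of the lift starting at e0' of a
   path whose lift from e0 ends at e, whenever [Phi e0 e0']. *)
Lemma fibre_map_extend (E1 E2 : covering Y)
    (Phi : Defs.total E1 -> Defs.total E2 -> Prop) :
  fibre_map Phi ->
  exists t : covering_hom E1 E2, forall e e', Phi e e' -> t e = e'.
Proof.
move=> [tot dom fn eqv].
have c1 := coveringP E1; have c2 := coveringP E2.
pose T e e' := exists (y : Y) (w : {path I from x0 to y in Y}) e0 e0',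
  [/\ Phi e0 e0', lifts (proj E1) w e0 e & lifts (proj E2) w e0' e'].
have Tex e : exists e', T e e'.
  have [w] := connected_path (proj E1 e) x0 connY lpcY.
  have [e0 we0] := lifts_exists c1 w (erefl (proj E1 e)).
  have [e0' Phi0] := tot e0 (lifts_proj we0).2.
  have [e' we'] := lifts_exists c2 (path_rev w) (dom _ _ Phi0).2.
  by exists e', (proj E1 e), (path_rev w), e0, e0'; split => //; exact: lifts_rev.
have Tproj e e' : T e e' -> proj E2 e' = proj E1 e.
  by move=> [y [w [e0 [e0' [_ /lifts_proj[_ ->] /lifts_proj[_ ->]]]]]].
have Tfun e e' e'' : T e e' -> T e e'' -> e' = e''.
  move=> [y [w [e0 [e0' [Phi0 we we']]]]] [z [v [e1 [e1' [Phi1 ve ve'']]]]].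
  have zy : z = y by rewrite -(lifts_proj ve).2 (lifts_proj we).2.
  move: zy v ve ve'' => -> v ve ve''.
  (* Two descriptions of [e] differ by the loop [w] followed by the reverse of [v]. Its monodromy
     takes [e0] to [e1], hence by equivariance [e0'] to [e1'], so [v] lifted from [e1'] ends at [e']
     as well as at [e'']. *)
  have loop := lifts_cat we (lifts_rev ve).
  have [d vd] := lifts_exists c2 (path_rev v) (lifts_proj we').2.
  have Phid := eqv _ _ _ _ _ Phi0 loop (lifts_cat we' vd).
  have := lifts_rev vd; rewrite path_revK (fn _ _ _ Phid Phi1) => ve'.
  exact: (lifts_unique c2 ve').
have Tlift y z (w : {path I from y to z in Y}) e e' d d' : T e e' ->
    lifts (proj E1) w e d -> lifts (proj E2) w e' d' -> T d d'.
  move=> [u [v [e0 [e0' [Phi0 ve ve']]]]] wd wd'.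
  have uy : u = y by rewrite -(lifts_proj ve).2 (lifts_proj wd).1.
  move: uy v ve ve' => -> v ve ve'.
  exists z, (path_cat v w), e0, e0'; split => //; first exact: lifts_cat wd.
  exact: lifts_cat wd'.
have [t tT] := choice Tex.
have tcts : continuous t.
  move=> e; pose x := proj E1 e; pose e' := t e.
  have e'x : proj E2 e' = x by exact: Tproj.
  have [U1 [s1 [U1x sf1]]] := is_covering_sections x c1.
  have [U2 [s2 [U2x sf2]]] := is_covering_sections x c2.
  have [V [Vx VU pV]] := lpcY
    (filterI (open_nbhs_nbhs U1x) (open_nbhs_nbhs U2x)).
  have U1e : U1 (proj E1 e) by exact: U1x.2.
  have U2e : U2 (proj E2 e') by rewrite e'x; exact: U2x.2.
  (* A path in [V] from [x] to the projection of [d] lifts along both sections, to [d] in [E1] and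
     to [s2 e' (proj E1 d)] in [E2]. As [T] is preserved by simultaneous lifting, [t] is locally a
     section after the projection. *)
  have near_t : \forall d \near e, s2 e' (proj E1 d) = t d.
    apply: filterS (filterI (section_nbhs sf1 U1e)
      (nbhs_preimage (c1.1 e) (open_nbhs_nbhs Vx))) => d [[_ ed] Vd].
    have [w wV] := pV x (proj E1 d) Vx.2 Vd.
    have wU1 : range w `<=` U1 by move=> z /wV /VU[].
    have wU2 : range w `<=` U2 by move=> z /wV /VU[].
    have l1 := lifts_section sf1 wU1 (erefl x : proj E1 e = x).
    have l2 := lifts_section sf2 wU2 e'x.
    rewrite ed in l1; exact: Tfun (Tlift _ _ _ _ _ _ _ (tT e) l1 l2) (tT d).
  apply: cvg_trans (near_eq_cvg near_t) _.
  have -> : t e = (s2 e' \o proj E1) e.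
    by rewrite /= -/x -e'x (section_self sf2).
  apply: (@continuous_comp _ _ _ (proj E1) (s2 e')); first exact: c1.1.
  by apply: (section_cts sf2) => //; exact: U1x.2 || exact: U2x.2.
exists (CoveringHom tcts (funext (fun e => esym (Tproj _ _ (tT e))))).
move=> e e' ee'; apply: Tfun (tT e) _.
have [ex ex'] := dom _ _ ee'.
by exists x0, (path_cst x0), e, e'; split => //; exact: lifts_cst.
Qed.

(** The extensions of the relation and of its converse compose to the identity on the fibres over
    [x0], hence everywhere by [covering_hom_unique]. *)
Lemma fibre_iso (E1 E2 : covering Y)
    (Phi : Defs.total E1 -> Defs.total E2 -> Prop) :
  fibre_map Phi -> fibre_map (fun e' e => Phi e e') ->
  @isomorphic (Cov Y) E1 E2.
Proof.
move=> PhiM PhiM'.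
have [u uP] := fibre_map_extend PhiM; have [v vP] := fibre_map_extend PhiM'.
have [tot _ _ _] := PhiM; have [tot' _ _ _] := PhiM'.
exists u, v; split; apply: covering_hom_unique => e /=.
  by move=> /tot[e' ee']; rewrite (uP _ _ ee') (vP _ _ ee').
by move=> /tot'[e' ee']; rewrite (vP _ _ ee') (uP _ _ ee').
Qed.

End fibre_relation.

(** * Coverings from local systems *)

Section subpaths.
Context {R : realType} {Y : topologicalType}.
Local Notation I := (unit_interval R).

Lemma range_cat (x y z : Y) (w : {path I from x to y in Y})
    (w' : {path I from y to z in Y}) (U : set Y) :
  range w `<=` U -> range w' `<=` U -> range (path_cat w w') `<=` U.
Proof.
move=> wU wU' _ [t _ <-]; rewrite /path_cat /= /mk_path /= /path_cat_fun.
by case: ifP => _; [apply: wU; eexists|apply: wU'; eexists].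
Qed.

Lemma range_rev (x y : Y) (w : {path I from x to y in Y}) (U : set Y) :
  range w `<=` U -> range (path_rev w) `<=` U.
Proof. by move=> wU _ [t _ <-]; apply: wU; eexists. Qed.

Section subpath.
Context {x y u v : Y} (w : {path I from x to y in Y}) (s t : R).
Context (su : w (clamp s) = u) (tv : w (clamp t) = v).

Definition subpath_fun (r : I) : Y := w (clamp (s + uval r * (t - s))).

Fact subpath_cts : continuous subpath_fun.
Proof.
apply: continuous_path_clamp; apply: contD; first exact: contC.
by apply: contM; [exact: uval_continuous|exact: contC].
Qed.

Fact subpath_zero : subpath_fun zero = u.
Proof. by rewrite /subpath_fun uval0 mul0r addr0. Qed.

Fact subpath_one : subpath_fun one = v.
Proof. by rewrite /subpath_fun uval1 mul1r addrC subrK. Qed.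

Definition subpath : {path I from u to v in Y} :=
  mk_path subpath_cts subpath_zero subpath_one.

Lemma subpathE r : subpath r = w (clamp (s + uval r * (t - s))).
Proof. by []. Qed.

End subpath.

(** Both sides reparametrize [w]: the first parameter runs from [r] to [s] and then from [s] to [t],
    the second straight from [r] to [t]. The three times may come in any order. *)
Lemma subpath_cat (x y u v z : Y) (w : {path I from x to y in Y}) (r s t : R)
    (ru : w (clamp r) = u) (sv : w (clamp s) = v) (tz : w (clamp t) = z) :
  path_homotopic (path_cat (subpath ru sv) (subpath sv tz)) (subpath ru tz).
Proof.
apply: (@reparam_homotopic _ _ _ _ _ _ w _ _
  (fun k => r + Num.min 1 (2 * uval k) * (s - r)
    + Num.max 0 (2 * uval k - 1) * (t - s)) (fun k => r + uval k * (t - r))).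
- have c2 : continuous (fun k : I => 2 * uval k).
    by apply: contM; [exact: contC|exact: uval_continuous].
  apply: contD; [apply: contD; first exact: contC|]; apply: contM; try exact: contC.
    by apply: contmin => //; exact: contC.
  by apply: contmax; [exact: contC|apply: contB => //; exact: contC].
- by apply: contD; [exact: contC|apply: contM; [exact: uval_continuous|exact: contC]].
- by rewrite uval0 mulr0 (min_idPr _) ?(max_idPl _) //; lra.
- by rewrite uval1 mulr1 (min_idPl _) ?(max_idPr _) //; lra.
- move=> k; rewrite /path_cat /= /mk_path /= /path_cat_fun !subpathE.
  case: ifP => k2.
    rewrite uval_clamp; last by have := uvalP k; lra.
    rewrite (min_idPr _) ?(max_idPl _); [|lra..].
    by congr (w (clamp _)); lra.
  rewrite uval_clamp; last by have := uvalP k; lra.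
  rewrite (min_idPl _) ?(max_idPr _); [|lra..].
  by congr (w (clamp _)); lra.
- by [].
Qed.

End subpaths.

(** A functor from the fundamental groupoid to sets, with one and the same set attached to every
    point. *)
Record local_system (R : realType) (Y : topologicalType) := LocalSystem {
  fibre : choiceType ;
  transport : forall y z : Y, {path (unit_interval R) from y to z in Y} ->
    fibre -> fibre ;
  transport_cst : forall y a, transport (path_cst y) a = a ;
  transport_cat : forall x y z (w : {path (unit_interval R) from x to y in Y})
    (w' : {path (unit_interval R) from y to z in Y}) a,
    transport (path_cat w w') a = transport w' (transport w a) ;
  transport_homotopic : forall y z
    (w w' : {path (unit_interval R) from y to z in Y}),
    path_homotopic w w' -> transport w =1 transport w' }.

Section local_system_space.
Context {R : realType} {Y : topologicalType} (L : local_system R Y).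
Local Notation I := (unit_interval R).

Definition etale_space : Type := (Y * fibre L)%type.

HB.instance Definition _ := Choice.on etale_space.

(* The topology is not the product topology: the sheet through [(y, a)] consists
   of the values of the transport of [a] along short paths. *)
Definition etale_open (O : set etale_space) : Prop :=
  forall y a, O (y, a) -> exists2 U : set Y, nbhs y U &
    forall z (w : {path I from y to z in Y}), range w `<=` U ->
      O (z, transport w a).

Fact etale_openT : etale_open setT.
Proof. by move=> y a _; exists setT => //; exact: filterT. Qed.

Fact etale_openI : setI_closed etale_open.
Proof.
move=> A B oA oB y a [/oA[U yU UA] /oB[V yV VB]].
exists (U `&` V); first exact: filterI.
by move=> z w wUV; split; [apply: UA|apply: VB] => ? /wUV[].
Qed.

Fact etale_open_bigU (J : Type) (f : J -> set etale_space) :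
  (forall j, etale_open (f j)) -> etale_open (\bigcup_j f j).
Proof.
move=> of_ y a [j _ /of_[U yU Uf]]; exists U => // z w /Uf fz.
by exists j.
Qed.

HB.instance Definition _ :=
  isOpenTopological.Build etale_space etale_openT etale_openI etale_open_bigU.

Definition etale_proj (e : etale_space) : Y := e.1.

Lemma etale_openP (O : set etale_space) : open O <-> etale_open O.
Proof. by []. Qed.

Lemma transportK x y (w : {path I from x to y in Y}) :
  cancel (transport (path_rev w) : fibre L -> _) (transport w).
Proof.
move=> a; rewrite -transport_cat (transport_homotopic (path_rev_cat w)).
exact: transport_cst.
Qed.

Lemma transport_revK x y (w : {path I from x to y in Y}) :
  cancel (transport w : fibre L -> _) (transport (path_rev w)).
Proof.
move=> a; rewrite -transport_cat (transport_homotopic (path_cat_rev w)).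
exact: transport_cst.
Qed.

Lemma etale_proj_cts : continuous etale_proj.
Proof.
apply/continuousP => A oA; apply/etale_openP => y a Ay; exists A.
  exact: open_nbhs_nbhs.
by move=> z w wA; apply: wA; exists one => //; exact: (path_one (s := w)).
Qed.

(** The lift at time [r] is the transport of [a] along the part of [w] up to [r]. A small change of
    [r] adds the transport along a short piece of [w], which is what the topology allows for. *)
Lemma lifts_etale x y (w : {path I from x to y in Y}) a :
  lifts etale_proj w (x, a) (y, transport w a).
Proof.
have w0 : w (clamp 0) = x by exact: (path_zero (s := w)).
have w1 : w (clamp 1) = y by exact: (path_one (s := w)).
pose q r : etale_space :=
  (w (clamp r), transport (subpath w0 (erefl (w (clamp r)))) a).
(* The type of a subpath mentions its end point. This form lets [w (clamp r)] be replaced by an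
   equal point. *)
have qE r v (rv : w (clamp r) = v) : q r = (v, transport (subpath w0 rv) a).
  by case: _ / rv.
apply/liftsP; exists q; split => //.
- apply/continuousP => O /etale_openP oO; apply: openP => r /oO[U rU UO].
  have cw : continuous (fun r => w (clamp r)).
    exact: continuous_path_clamp (@cont_id _).
  have /nbhs_ballP[d /= d0 dU] := nbhs_preimage (cw r) rU.
  apply/nbhs_ballP; exists d => // r' /= rr'.
  rewrite /q /= -(transport_homotopic (subpath_cat w0 (erefl (w (clamp r))) _)).
  rewrite transport_cat; apply: UO => _ [t _ <-]; rewrite subpathE.
  apply: (dU (_ : R)); move: rr'; rewrite /ball /= => rr'.
  rewrite opprD addNKr normrN normrM distrC.
  apply: le_lt_trans rr'; rewrite ler_piMl // ger0_norm; have := uvalP t; lra.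
- rewrite (qE _ _ w0); congr pair; rewrite -[RHS](transport_cst x).
  by congr transport; apply/path_eqP => t; rewrite subpathE subrr mulr0 addr0 w0.
- rewrite (qE _ _ w1); congr (_, transport _ a).
  by apply/path_eqP => t; rewrite subpathE subr0 mulr1 add0r uvalK.
Qed.

End local_system_space.

Section etale_covering.
Context {R : realType} {Y : topologicalType} (L : local_system R Y).
Context (lpcY : locally_path_connected R Y).
Context (slscY : semilocally_simply_connected R Y).
Local Notation I := (unit_interval R).

(** Going along [w] and back along [w'] gives a loop at [y] inside [U0], which is trivial in the
    fundamental group. *)
Lemma simply_transported_nbhs (y : Y) : exists2 U : set Y, open_nbhs y U &
  path_connected_set R U /\
  forall z (w w' : {path I from y to z in Y}) (a : fibre L),
    range w `<=` U -> range w' `<=` U -> transport w a = transport w' a.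
Proof.
have [U0 yU0 trivial] := slscY y; have [U [yU UU0 pU]] := lpcY yU0.
exists U => //; split=> // z w w' a wU wU'.
have /pi1_eqP h :
    \pi_(pi1 R y) (path_cat w (path_rev w')) = \pi_(pi1 R y) (path_cst y).
  apply: trivial; apply: subset_trans UU0; apply: range_cat => //.
  exact: range_rev.
have := transport_homotopic (l := L) h a; rewrite transport_cat transport_cst => wa.
by rewrite -[in RHS]wa transportK.
Qed.

Lemma etale_is_covering : is_covering (@etale_proj R Y L).
Proof.
split=> [|y]; first exact: etale_proj_cts.
have [U yU [pU trU]] := simply_transported_nbhs y.
exists U => //.
(* The sheet labelled [a] collects the transports of [a] from [y] along paths inside [U]. By [trU]
   it has only one point over each point of [U]. *)
pose V a : set (etale_space L) := [set e | exists2 w : {path I from y to e.1 in Y},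
  range w `<=` U & e.2 = transport w a].
have VU a e : V a e -> U e.1.
  by move=> [w wU _]; apply: wU; exists one => //; exact: (path_one (s := w)).
have Vmove a z z' b (w : {path I from z to z' in Y}) :
    V a (z, b) -> range w `<=` U -> V a (z', transport w b).
  move=> [v /= vU ->] wU; exists (path_cat v w) => /=; first exact: range_cat.
  by rewrite transport_cat.
have Vfun a z b b' : V a (z, b) -> V a (z, b') -> b = b'.
  by move=> [v /= vU ->] [v' /= vU' ->]; exact: trU.
have Vsec a z : U z -> exists b, V a (z, b).
  move=> Uz; have [w wU] := pU y z yU.2 Uz.
  by exists (transport w a), w.
exists (range V); split.
- move=> _ [a _ <-]; apply/etale_openP => z b Vzb; exists U.
    by apply: open_nbhs_nbhs; split; [exact: yU.1|exact: VU Vzb].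
  by move=> z' w wU; exact: Vmove.
- move=> _ _ [a _ <-] [a' _ <-] [[z b] [[w /= wU wb] [w' /= wU' wb']]].
  congr V; rewrite -(transport_revK w a) -wb wb' -(trU _ w w' a' wU wU').
  by rewrite transport_revK.
- apply/seteqP; split=> [[z b] /= Uz|[z b] [_ [a _ <-]] /VU //].
  have [w wU] := pU y z yU.2 Uz.
  exists (V (transport (path_rev w) b)); first by eexists.
  by exists w => //=; rewrite transportK.
move=> _ [a _ <-].
have hU (e : set_type (V a)) : etale_proj (val e) \in U.
  by apply/mem_set; exact: (VU a _ (set_valP e)).
pose h (e : set_type (V a)) : set_type U := exist (fun z => z \in U) _ (hU e).
have /choice[b bV] : forall z : set_type U, exists b, V a (val z, b).
  by move=> z; apply: Vsec; exact: (set_valP z).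
pose g (z : set_type U) : set_type (V a) :=
  exist (fun e => e \in V a) (val z, b z) (mem_set (bV z)).
exists h; last by [].
split.
  apply: (@continuous_comp_initial _ _ _ set_val).
  exact: cont_comp (@initial_continuous _ _ set_val) (@etale_proj_cts _ _ L).
exists g; split.
- apply: (@continuous_comp_initial _ _ _ set_val).
  apply/continuousP => O /etale_openP oO; apply: openP => z /oO[W zW WO].
  have [W' [zW' W'W pW']] := lpcY (filterI zW
    (open_nbhs_nbhs (conj yU.1 (set_valP z)))).
  have := nbhs_preimage (@initial_continuous _ _ set_val z) (open_nbhs_nbhs zW').
  apply: filterS => z' /= W'z'; have [w wW'] := pW' _ _ zW'.2 W'z'.
  (* The sheet has a single point over [z'], so [g z'] is the transport of [b z] along a short path
     from [z]. *)
  have -> : set_val (g z') = (val z', transport w (b z)) :> etale_space L.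
    congr pair; apply: Vfun (bV z') (Vmove _ _ _ _ _ (bV z) _).
    by move=> x /wW' /W'W[].
  by apply: WO => x /wW' /W'W[].
- have gE (e : etale_space L) (z : set_type U) :
      V a e -> val z = e.1 -> (val z, b z) = e.
    case: e => [x c] Vc zx; have := bV z; rewrite zx => Vb.
    by congr pair; exact: (Vfun a x).
  by move=> e; apply: val_inj; apply: gE => //; exact: (set_valP e).
- by move=> z; exact: val_inj.
Qed.

Definition etale_covering : covering Y := Covering etale_is_covering.

End etale_covering.

(** * Actions of a group and of a proper subgroup *)

Section twin_actions.
Context (G : groupType).
Local Open Scope group_scope.

Definition right_action (A : Type) (act : A -> G -> A) : Prop :=
  (forall a, act a 1 = a) /\ (forall a g h, act a (g * h) = act (act a g) h).

(** The empty and the full subset are excluded because every translation fixes them. *)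
Definition properly_nonempty (S : set G) : bool :=
  `[< S !=set0 /\ S <> setT >].

Definition proper_subset : choiceType := {S : set G | properly_nonempty S}.

Definition right_translate (S : set G) (g : G) : set G := [set x | S (x * g^-1)].

Fact right_translate_proper (S : proper_subset) g :
  properly_nonempty (right_translate (val S) g).
Proof.
have /asboolP[[x Sx] ST] := valP S; apply/asboolP; split.
  by exists (x * g); rewrite /right_translate /= mulgK.
move=> SgT; apply: ST; apply/seteqP; split => // y _.
by rewrite -[y](mulgK g); have /seteqP[_] := SgT; exact.
Qed.

Definition translate (S : proper_subset) g : proper_subset :=
  exist (fun S => properly_nonempty S) _ (right_translate_proper S g).

Lemma translate_action : right_action translate.
Proof.
split=> [S|S g h]; apply: val_inj; apply/funext => x;
  by rewrite /= /right_translate /= ?invg1 ?mulg1 ?invgM ?mulgA.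
Qed.

(** If [x] lies in [S], translation by [x^-1 * y] puts [y] in the translate, so a fixed [S] would be
    everything. *)
Lemma translate_no_fixpoint S : ~ forall g, translate S g = S.
Proof.
move=> fixS; have /asboolP[[x Sx] []] := valP S.
apply/seteqP; split => // y _.
have <- := congr1 val (fixS (x^-1 * y)).
by rewrite /= /right_translate /= invgM invgK mulVKg.
Qed.

(* [A] is a countable sum of copies of the set of properly nonempty subsets of
   [G]. The subgroup [H] is one of these subsets and is fixed by [H], so [A] has
   infinitely many points fixed by [H] and absorbs one more. *)
Lemma twin_actions (H : set G) :
  H 1 -> (forall g h, H g -> H h -> H (g * h)) ->
  (forall g, H g -> H g^-1) -> H <> setT ->
  exists (A : choiceType) (act : A -> G -> A)
         (sigma : A -> option A) (tau : option A -> A),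
    [/\ right_action act, forall a, ~ (forall g, act a g = a),
        cancel sigma tau, cancel tau sigma &
        forall a h, H h -> sigma (act a h) = omap (act^~ h) (sigma a)].
Proof.
move=> H1 HM HV HT; have [tr1 trM] := translate_action.
have H_proper : properly_nonempty H by apply/asboolP; split => //; exists 1.
pose s : proper_subset := exist (fun S => properly_nonempty S) H H_proper.
have sH h : H h -> translate s h = s.
  move=> Hh; apply: val_inj; apply/seteqP.
  split => x; rewrite /= /right_translate /=.
    by move=> Hx; rewrite -(mulgVK h x); exact: HM.
  by move=> Hx; apply: HM => //; exact: HV.
(* Elements of [H] move no other subset to [s], so the case distinction in [sigma] is invariant
   under [H]. *)
have translate_s S h : H h -> (translate S h == s) = (S == s).
  move=> Hh; apply/eqP/eqP => [Ss|->]; last exact: sH.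
  by rewrite -[S]tr1 -[X in translate S X](mulgV h) trM Ss sH //; exact: HV.
(* A Hilbert hotel on the copies of [s]: copy [n.+1] moves down to copy [n], copy [0] becomes
   [None], and all other points stay. *)
pose sigma (a : nat * proper_subset) : option (nat * proper_subset) :=
  if a.2 == s then (if a.1 is n.+1 then Some (n, s) else None) else Some a.
pose tau (c : option (nat * proper_subset)) : nat * proper_subset :=
  if c is Some a then (if a.2 == s then (a.1.+1, s) else a) else (0, s)%N.
exists (nat * proper_subset)%type, (fun a g => (a.1, translate a.2 g)), sigma, tau.
split.
- by split=> [[n S]|[n S] g h] /=; rewrite ?tr1 ?trM.
- move=> [n S] /= fixS; apply: (@translate_no_fixpoint S) => g.
  exact: (congr1 snd (fixS g)).
- move=> [n S]; rewrite /sigma /=; have [->|Ss] := eqVneq S s.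
    by case: n => [|n] //=; rewrite eqxx.
  by rewrite /= (negPf Ss).
- move=> [[n S]|] /=; last by rewrite /sigma eqxx.
  rewrite /sigma; have [->|Ss] := eqVneq S s; first by rewrite eqxx.
  by rewrite /= (negPf Ss).
- move=> [n S] h Hh; rewrite /sigma /= translate_s //.
  by case: eqP => //= _; case: n => //= n; rewrite sH.
Qed.

End twin_actions.

(** * Fibres of pullbacks *)

Section pullback_lifts.
Context {R : realType} {X Y : topologicalType} (f : continuousType X Y).
Local Notation I := (unit_interval R).

Lemma pullback_eq (E : covering Y) (v : pullback_total f E) :
  f (val v).1 = proj E (val v).2.
Proof. exact: (set_valP v). Qed.

Definition pullback_pair (E : covering Y) x e (xe : f x = proj E e) :
    pullback_total f E :=
  exist (fun v => v \in @pullback_set X Y f E) (x, e) (mem_set xe).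

Lemma lifts_pullback (E : covering Y) (x x' : X)
    (w : {path I from x to x' in X}) (v d : pullback_total f E) :
  lifts (@pullback_proj X Y f E) w v d ->
  lifts (proj E) (f \o w : {path I from f x to f x' in Y}) (val v).2 (val d).2.
Proof.
move=> /liftsP[q [cq <- <- qw]]; apply/liftsP.
exists (fun r => (val (q r)).2); split => // [|r].
  exact: cont_comp cq (@pullback_snd_cts _ _ f E).
by rewrite -pullback_eq /= -qw.
Qed.

Context (x0 : X).

(** A loop [w] of [Y] is homotopic to the image of a loop [z] of [X]. The morphism [u] commutes with
    lifts of [z], and homotopic loops have lifts with the same end, so equivariance passes to
    [w]. *)
Lemma fibre_map_of_pullback (E1 E2 : covering Y)
    (u : covering_hom (pullback f E1) (pullback f E2)) :
  (forall b : pi1 R (f x0), exists a : pi1 R x0, pi1_map f a = b) ->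
  fibre_map R (f x0) (fun e e' => exists2 v : pullback_total f E1,
    val v = (x0, e) & val (u v) = (x0, e')).
Proof.
move=> surj.
have u1 v : (val (u v)).1 = (val v).1.
  exact: (esym (congr1 (@^~ v) (cov_proj u))).
split.
- move=> e ex; exists (val (u (pullback_pair (esym ex)))).2.
  exists (pullback_pair (esym ex)) => //.
  by rewrite [LHS]surjective_pairing u1.
- move=> e e' [v ve uve']; have := pullback_eq v; have := pullback_eq (u v).
  by rewrite ve uve' /= => -> ->.
- move=> e e1 e2 [v ve ve1] [v' ve' ve2].
  have vv' : v = v' by apply: val_inj; rewrite ve.
  by move: ve1; rewrite vv' ve2 => -[].
move=> w e e' d d' [v ve ve'] ed ed'.
have [a] := surj (\pi_(pi1 R (f x0)) w).
elim/quotW: a => z; rewrite pi1_mapE => /pi1_eqP zw.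
have vx : pullback_proj v = x0 by rewrite /pullback_proj ve.
have [c zc] := lifts_exists (coveringP (pullback f E1)) z vx.
have c1 : (val c).1 = x0 by exact: (lifts_proj zc).2.
have zed := lifts_pullback zc; rewrite ve /= in zed.
have zed' := lifts_pullback (lifts_hom u zc); rewrite ve' /= in zed'.
exists c.
  rewrite [LHS]surjective_pairing c1; congr pair.
  exact: (lifts_unique (coveringP E1) (lifts_homotopic (coveringP E1) zw zed) ed).
rewrite [LHS]surjective_pairing u1 c1; congr pair.
exact: (lifts_unique (coveringP E2) (lifts_homotopic (coveringP E2) zw zed') ed').
Qed.

Context (lpcY : locally_path_connected R Y).
Context (slscY : semilocally_simply_connected R Y).

(** Lifts in the pullback project to lifts in the étale space, whose ends are given by transport
    along [f \o w]. Equivariance therefore only involves loops of [X]. *)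
Lemma fibre_map_pullback_etale (L1 L2 : local_system R Y)
    (P : fibre L1 -> fibre L2 -> Prop) :
  (forall a, exists b, P a b) ->
  (forall a b b', P a b -> P a b' -> b = b') ->
  (forall (w : {path I from x0 to x0 in X}) a b, P a b ->
     P (transport (f \o w : {path I from f x0 to f x0 in Y}) a)
       (transport (f \o w : {path I from f x0 to f x0 in Y}) b)) ->
  @fibre_map R X x0 (pullback f (etale_covering L1 lpcY slscY))
    (pullback f (etale_covering L2 lpcY slscY))
    (fun v v' => [/\ (val v).1 = x0, (val v').1 = x0 & P (val v).2.2 (val v').2.2]).
Proof.
move=> tot fn eqv.
have E2 L (v : pullback_total f (etale_covering L lpcY slscY)) :
    (val v).1 = x0 -> (val v).2 = (f x0, (val v).2.2).
  by move=> vx; have := pullback_eq v; rewrite vx; case: (val v).2 => ? ? /= ->.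
split.
- move=> v vx; have [b ab] := tot (val v).2.2.
  have xb : f x0 = proj (etale_covering L2 lpcY slscY) (f x0, b) by [].
  by exists (pullback_pair xb).
- by move=> v v' [].
- move=> v v1 v2 [vx v1x P1] [_ v2x P2]; apply: val_inj.
  rewrite [LHS]surjective_pairing [RHS]surjective_pairing v1x v2x; congr pair.
  by rewrite (E2 _ v1) // (E2 _ v2) // (fn _ _ _ P1 P2).
move=> w v v' d d' [vx v'x P1] vd v'd'.
have dx := (lifts_proj vd).2; have d'x := (lifts_proj v'd').2.
split => //.
have := lifts_pullback vd; rewrite (E2 _ v) // => l.
have := lifts_pullback v'd'; rewrite (E2 _ v') // => l'.
have ce L := @etale_is_covering R Y L lpcY slscY.
rewrite -(lifts_unique (ce _) (lifts_etale _ _) l).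
rewrite -(lifts_unique (ce _) (lifts_etale _ _) l') /=.
exact: eqv.
Qed.

End pullback_lifts.

(** * Local systems from actions of the fundamental group *)

Section local_system_of_action.
Context {R : realType} {Y : topologicalType} (y0 : Y).
Context (connY : connected [set: Y]) (lpcY : locally_path_connected R Y).
Local Notation I := (unit_interval R).
Local Notation G := (pi1 R y0).
Context (A : choiceType) (act : A -> G -> A).
Context (actP : right_action act).

(** Making [c y0] null-homotopic ensures that loops at [y0] act by their own class and not by a
    conjugate. *)
Lemma based_paths : exists c : forall y, {path I from y0 to y in Y},
  path_homotopic (c y0) (path_cst y0).
Proof.
have pth y : {path I from y0 to y in Y}.
  by have /inhabited_witness := connected_path y0 y connY lpcY.
exists (fun y => path_cat (path_rev (pth y0)) (pth y)).
exact: path_rev_cat.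
Qed.

Lemma path_cat_cancel (x y z t : Y) (a : {path I from x to y in Y})
    (b : {path I from z to y in Y}) (c : {path I from y to t in Y}) :
  path_homotopic (path_cat (path_cat a (path_rev b)) (path_cat b c))
    (path_cat a c).
Proof.
apply: path_homotopic_trans (path_homotopic_sym (path_catA _ _ _)) _.
apply: path_cat_homotopic (path_homotopic_refl _) _.
apply: path_homotopic_trans (path_catA _ _ _) _.
apply: path_homotopic_trans (path_cat1p _).
exact: path_cat_homotopic (path_rev_cat _) (path_homotopic_refl _).
Qed.

(** Transport along [w] from [y] to [z] is the action of the loop that runs along [c y], then [w],
    then back along [c z]. In a composite the inner path and its reverse cancel. *)
Lemma local_system_of_action : exists (L : local_system R Y)
  (phi : A -> fibre L) (psi : fibre L -> A), [/\ cancel phi psi, cancel psi phi &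
    forall (w : {path I from y0 to y0 in Y}) a,
      transport w (phi a) = phi (act a (\pi_G w))].
Proof.
have [c c0] := based_paths; have [act1 actM] := actP.
pose m y z (w : {path I from y to z in Y}) : {path I from y0 to y0 in Y} :=
  path_cat (path_cat (c y) w) (path_rev (c z)).
have m_cst y : \pi_G (m y y (path_cst y)) = 1%g.
  apply/pi1_eqP; apply: path_homotopic_trans (path_cat_rev (c y)).
  exact: path_cat_homotopic (path_catp1 _) (path_homotopic_refl _).
have m_cat x y z (w : {path I from x to y in Y}) (w' : {path I from y to z in Y}) :
    \pi_G (m x z (path_cat w w')) = (\pi_G (m x y w) * \pi_G (m y z w'))%g.
  rewrite [RHS]pi1_mulE; apply/pi1_eqP; apply: path_homotopic_sym.
  apply: path_homotopic_trans (path_cat_homotopic (path_homotopic_refl _)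
    (path_homotopic_sym (path_catA _ _ _))) _.
  apply: path_homotopic_trans (path_cat_cancel _ _ _) _.
  apply: path_homotopic_trans (path_catA _ _ _) _.
  exact: path_cat_homotopic (path_homotopic_sym (path_catA _ _ _))
    (path_homotopic_refl _).
have m_homotopic y z (w w' : {path I from y to z in Y}) : path_homotopic w w' ->
    \pi_G (m y z w) = \pi_G (m y z w').
  move=> ww'; apply/pi1_eqP; apply: path_cat_homotopic (path_homotopic_refl _).
  exact: path_cat_homotopic (path_homotopic_refl _) ww'.
have m_loop (w : {path I from y0 to y0 in Y}) : \pi_G (m y0 y0 w) = \pi_G w.
  apply/pi1_eqP.
  apply: path_homotopic_trans (path_cat_homotopic (path_cat_homotopic c0
    (path_homotopic_refl w)) (path_rev_homotopic c0)) _.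
  have -> : path_rev (path_cst y0) = path_cst y0 :> {path I from y0 to y0 in Y}.
    exact/path_eqP.
  exact: path_homotopic_trans (path_catp1 _) (path_cat1p _).
pose tr y z (w : {path I from y to z in Y}) (a : A) := act a (\pi_G (m y z w)).
have tr_cst y a : tr y y (path_cst y) a = a by rewrite /tr m_cst.
have tr_cat x y z (w : {path I from x to y in Y})
    (w' : {path I from y to z in Y}) a :
  tr x z (path_cat w w') a = tr y z w' (tr x y w a) by rewrite /tr m_cat actM.
have tr_homotopic y z (w w' : {path I from y to z in Y}) : path_homotopic w w' ->
  tr y z w =1 tr y z w' by move=> ww' a; rewrite /tr (m_homotopic _ _ _ _ ww').
exists (LocalSystem tr_cst tr_cat tr_homotopic), id, id; split => // w a.
by rewrite /= /tr m_loop.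
Qed.

End local_system_of_action.

(** * Surjectivity on fundamental groups and essential injectivity *)

Section surjectivity_injectivity.
Context (R : realType) (X Y : topologicalType) (f : continuousType X Y) (x0 : X).
Context (lpcY : locally_path_connected R Y) (connY : connected [set: Y]).
Local Notation I := (unit_interval R).

Lemma pullback_essentially_injective :
  (forall b : pi1 R (f x0), exists a : pi1 R x0, pi1_map f a = b) ->
  essentially_injective (pullback_functor f).
Proof.
move=> surj E1 E2 [u [v [vu uv]]].
have vuK w : v (u w) = w by move/(congr1 (fun t : covering_hom _ _ => t w)): vu.
have uvK w : u (v w) = w by move/(congr1 (fun t : covering_hom _ _ => t w)): uv.
apply: (fibre_iso connY lpcY (fibre_map_of_pullback u surj)).
(* Since [u] and [v] are mutually inverse, the relation defined by [v] is the converse of the one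
   defined by [u]. *)
have := fibre_map_of_pullback v surj; congr fibre_map.
apply/funext => e'; apply/funext => e; apply/propext.
by split=> -[w we we']; [exists (v w); rewrite ?uvK|exists (u w); rewrite ?vuK].
Qed.

Context (connX : connected [set: X]) (lpcX : locally_path_connected R X).
Context (slscY : semilocally_simply_connected R Y).

Lemma essentially_injective_pi1_surj :
  essentially_injective (pullback_functor f) ->
  forall b : pi1 R (f x0), exists a : pi1 R x0, pi1_map f a = b.
Proof.
move=> inj b; apply: contrapT => bH.
pose H : set (pi1 R (f x0)) := range (@pi1_map R X Y f x0).
have [||||A [act [sigma [tau [actP nofix sigmaK tauK sigma_act]]]]] :=
  @twin_actions _ H.
- by exists 1%g => //; exact: pi1_map_one.
- by move=> _ _ [a _ <-] [c _ <-]; exists (a * c)%g => //; exact: pi1_map_mul.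
- move=> _ [a _ <-]; exists (a^-1)%g => //; apply: (mulIg (pi1_map f a)).
  by rewrite -pi1_map_mul !mulVg pi1_map_one.
- by move=> HT; apply: bH; have /seteqP[_ /(_ b Logic.I)[a _]] := HT; exists a.
have actoP : right_action (fun c g => omap (act^~ g) c).
  by case: actP => act1 actM; split=> [[a|]|[a|] g h] //=; rewrite ?act1 ?actM.
have [LA [phiA [psiA [phiAK psiAK trA]]]] :=
  local_system_of_action connY lpcY actP.
have [LB [phiB [psiB [phiBK psiBK trB]]]] :=
  local_system_of_action connY lpcY actoP.
have psiA_tr (w : {path I from f x0 to f x0 in Y}) k :
    psiA (transport w k) = act (psiA k) (\pi_(pi1 R (f x0)) w).
  by rewrite -[k in LHS]psiAK trA phiAK.
have psiB_tr (w : {path I from f x0 to f x0 in Y}) l :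
    psiB (transport w l) = omap (act^~ (\pi_(pi1 R (f x0)) w)) (psiB l).
  by rewrite -[l in LHS]psiBK trB phiBK.
pose EA := etale_covering LA lpcY slscY; pose EB := etale_covering LB lpcY slscY.
(* The graph of [sigma], read through the identifications of the fibres with [A] and [option A]. It
   respects loops coming from [X] because their classes land in [H]. *)
pose P (k : fibre LA) (l : fibre LB) := psiB l = sigma (psiA k).
have P_tr (w : {path I from x0 to x0 in X}) k l : P k l ->
    P (transport (f \o w : {path I from f x0 to f x0 in Y}) k)
      (transport (f \o w : {path I from f x0 to f x0 in Y}) l).
  rewrite /P => kl; rewrite psiA_tr psiB_tr kl -pi1_mapE sigma_act //.
  by eexists.
have /inj[t [u _]] : isomorphic (pullback_functor f EA) (pullback_functor f EB).
  have AB := fibre_map_pullback_etale lpcY slscY (P := P) _ _ P_tr.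
  have BA := fibre_map_pullback_etale lpcY slscY (P := fun l k => P k l) _ _
    (fun w k l => P_tr w l k).
  apply: (fibre_iso connX lpcX (AB _ _)).
  - by move=> k; exists (phiB (sigma (psiA k))); rewrite /P phiBK.
  - by move=> k l l'; rewrite /P => <- /(can_inj psiBK).
  - move: BA; rewrite (_ : (fun v v' => _) = (fun (v : Defs.total (pullback f EB))
        (v' : Defs.total (pullback f EA)) =>
        [/\ (val v').1 = x0, (val v).1 = x0 & P (val v').2.2 (val v).2.2])).
      apply; first by move=> l; exists (phiA (tau (psiB l))); rewrite /P phiAK tauK.
      by move=> l k k'; rewrite /P => -> /(can_inj sigmaK)/(can_inj psiAK).
    by apply/funext => v; apply/funext => v'; apply/propext; split=> -[].
(* The point [None] is fixed by the whole group, so every loop lifts to a loop at [e]. The morphism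
   [u] carries these to loops at [u e], which gives a fixed point in [A]. *)
pose e : Defs.total EB := (f x0, phiB None).
have ue : etale_proj (u e) = f x0 by have := congr1 (@^~ e) (cov_proj u).
apply: (nofix (psiA (u e).2)); elim/quotW => w.
have := lifts_etale w (phiB None); rewrite trB /= => /(lifts_hom u) we.
have ueE : u e = (f x0, (u e).2) by rewrite -ue; case: (u e).
have := lifts_etale w (u e).2; rewrite -ueE => we'.
have /(congr1 (fun d : etale_space LA => psiA d.2)) :=
  lifts_unique (coveringP EA) we we'.
by rewrite /= psiA_tr.
Qed.

End surjectivity_injectivity.

Theorem corollary5p7 (R : realType) (X Y : topologicalType)
    (f : continuousType X Y) (x0 : X)
    (connX : connected [set: X]) (connY : connected [set: Y])
    (lpcX : locally_path_connected R X) (lpcY : locally_path_connected R Y)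
    (slscX : semilocally_simply_connected R X)
    (slscY : semilocally_simply_connected R Y) :
  (forall b : pi1 R (f x0), exists a : pi1 R x0, pi1_map f a = b) <->
  essentially_injective (pullback_functor f).
Proof.
split; first exact: pullback_essentially_injective.
exact: essentially_injective_pi1_surj.
Qed.
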